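(* Let $M$ be a compact Vaisman manifold, $B$ a holomorphic Hermitian vector bundle on $M$, and $\Theta_B\in\Lambda^{1,1}(M)\otimes\operatorname{End}(B)$ the curvature of its Chern connection. Let $\Lambda_0:\Lambda^{1,1}(M)\otimes\operatorname{End}(B)\to\operatorname{End}(B)$ be the Hodge-type operator associated with $\omega_0$. Assume that the self-adjoint operator $\sqrt{-1}\,\Lambda_0(\Theta_B)$ is strictly negative everywhere on $M$. Then $B$ has no non-zero global holomorphic sections.
   Context: A locally conformal Kähler (LCK) manifold is a complex manifold $(M,I)$ with a Hermitian metric $g$, a torsion-free connection $\nabla$ and a closed $1$-form $\theta$ (the Lee form) such that $\nabla g=g\otimes\theta$ and $\nabla I=0$. A Vaisman manifold is an LCK manifold whose Lee form is parallel with respect to the Levi-Civita connection of $g$; it is assumed that $\theta\neq0$, normalized by $|\theta|=1$. Let $d^c=\frac{\partial-\bar\partial}{\sqrt{-1}}$ and $\omega_0:=d^c\theta$. In a local orthonormal coframe $\xi_1,\dots,\xi_{n-1},\sqrt2\,\theta^{1,0}$ of $\Lambda^{1,0}(M)$ ($n=\dim_{\mathbb C}M$, $\theta^{1,0}$ the $(1,0)$-part of $\theta$) one has $\omega_0=\sqrt{-1}\sum_{i=1}^{n-1}\xi_i\wedge\bar\xi_i$. The operator $\Lambda_0:\Lambda^p(M)\to\Lambda^{p-2}(M)$ is the Hermitian adjoint of $L_0:\eta\mapsto\eta\wedge\omega_0$, extended to forms with coefficients in a bundle by acting on the form factor. *)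

(* Defs.v *)
From mathcomp Require Import all_boot all_order all_algebra.
From mathcomp Require Import all_classical all_reals all_analysis.
From mathcomp Require Import complex ring.

Set Implicit Arguments.
Unset Strict Implicit.
Unset Printing Implicit Defensive.

Import Order.TTheory GRing.Theory Num.Theory.
Import numFieldNormedType.Exports.

Local Open Scope classical_set_scope.
Local Open Scope ring_scope.
Local Open Scope complex_scope.

(** The point z = x + iy of C^n is encoded as the real row vector
    [row_mx x y : 'rV[R]_(n + n)].  Linear maps act on row vectors from the
    right, as for the library's [jacobian]: the differential of f at x is
    [u |-> u *m jacobian f x]. *)

Section Calculus.
Variables (R : realType) (n : nat).
Local Notation E := 'rV[R]_(n + n).
Local Notation C := R[i].

(* Multiplication by i on C^n: [row_mx x y *m cplxJ = row_mx (- y) x]. *)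
Definition cplxJ : 'M[R]_(n + n) := block_mx 0 1%:M (- 1%:M) 0.

Definition basis (a : 'I_(n + n)) : E := delta_mx 0 a.

(* Only meant for open [U]. *)
Fixpoint Ck (k : nat) (U : set E) (f : E -> R) : Prop :=
  match k with
  | 0%N => forall x, U x -> {for x, continuous f}
  | k'.+1 => (forall x, U x -> differentiable f x) /\
             (forall v : E, Ck k' U ('D_v f))
  end.

Definition smooth (U : set E) (f : E -> R) : Prop := forall k, Ck k U f.

Definition smooth_mx p q (U : set E) (F : E -> 'M[R]_(p, q)) : Prop :=
  forall a b, smooth U (fun x => F x a b).

Definition smoothC (U : set E) (f : E -> C) : Prop :=
  smooth U (fun x => complex.Re (f x)) /\ smooth U (fun x => complex.Im (f x)).

Definition smoothC_mx p q (U : set E) (F : E -> 'M[C]_(p, q)) : Prop :=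
  forall a b, smoothC U (fun x => F x a b).

Definition derC (v : E) (f : E -> C) (x : E) : C :=
  ('D_v (fun y => complex.Re (f y)) x) +i* ('D_v (fun y => complex.Im (f y)) x).

Definition pder p q (a : 'I_(n + n)) (F : E -> 'M[R]_(p, q)) (x : E) :
    'M[R]_(p, q) :=
  \matrix_(b, c) 'D_(basis a) (fun y => F y b c) x.

Definition pderC p q (a : 'I_(n + n)) (F : E -> 'M[C]_(p, q)) (x : E) :
    'M[C]_(p, q) :=
  \matrix_(b, c) derC (basis a) (fun y => F y b c) x.

(* The values at the tangent vector [v] of the 1-forms ∂f and ∂̄f, that is of
   the C-linear and C-antilinear parts of df. *)
Definition del (v : E) (f : E -> C) (x : E) : C :=
  2^-1 * (derC v f x - 'i * derC (v *m cplxJ) f x).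

Definition delbar (v : E) (f : E -> C) (x : E) : C :=
  2^-1 * (derC v f x + 'i * derC (v *m cplxJ) f x).

(* By Goursat's theorem, the smoothness requirement is not restrictive. *)
Definition holomorphic (U : set E) (f : E -> C) : Prop :=
  smoothC U f /\ (forall x, U x -> forall v, delbar v f x = 0).

(** A complex 1-form is given by its components on [basis a], and a 2-form by
    the antisymmetric matrix of its values on pairs of basis vectors.  The real
    coordinates x_a are real parts of C-affine functions, so ∂(dx_a) = 0 =
    ∂̄(dx_a), and ∂(sum_a α_a dx_a) = sum_a ∂α_a /\ dx_a; likewise for ∂̄. *)

Definition del1 (al : E -> 'I_(n + n) -> C) (x : E) : 'M[C]_(n + n) :=
  \matrix_(a, b) (del (basis a) (fun y => al y b) x
                  - del (basis b) (fun y => al y a) x).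

Definition delbar1 (al : E -> 'I_(n + n) -> C) (x : E) : 'M[C]_(n + n) :=
  \matrix_(a, b) (delbar (basis a) (fun y => al y b) x
                  - delbar (basis b) (fun y => al y a) x).

(* d^c = (∂ - ∂̄) / sqrt(-1) on 1-forms. *)
Definition dc1 (al : E -> 'I_(n + n) -> C) (x : E) : 'M[C]_(n + n) :=
  'i^-1 *: (del1 al x - delbar1 al x).

(* The Hermitian product induced on 2-forms by the real inner product with Gram
   matrix [G]; the factor 1/2 makes e^a /\ e^b (a < b) orthonormal when the
   e^a are. *)
Definition form2_dot (G : 'M[R]_(n + n)) (al be : 'M[C]_(n + n)) : C :=
  2^-1 * \sum_a \sum_b \sum_c \sum_d
    (invmx G a c * invmx G b d)%:C * al a b * conjc (be c d).

Lemma form2_dotC (G : 'M[R]_(n + n)) (al be : 'M[C]_(n + n)) :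
  G^T = G -> form2_dot G al be = conjc (form2_dot G be al).
Proof.
move=> GT; rewrite /form2_dot [RHS]rmorphM.
have h2 : conjc (2^-1 : C) = 2^-1 by rewrite conjc_inv conjc_nat.
rewrite [X in _ = X * _]h2; congr (_ * _); rewrite rmorph_sum.
under [RHS]eq_bigr do rewrite rmorph_sum.
under [RHS]eq_bigr do under eq_bigr do rewrite rmorph_sum.
under [RHS]eq_bigr do under eq_bigr do under eq_bigr do rewrite rmorph_sum.
rewrite pair_bigA [RHS]pair_bigA /=.
under eq_bigr do rewrite pair_bigA /=.
under [RHS]eq_bigr do rewrite pair_bigA /=.
rewrite exchange_big; apply: eq_bigr => -[c d] _; apply: eq_bigr => -[a b] _ /=.
have iT u v : invmx G u v = invmx G v u by rewrite -{1}GT -trmx_inv mxE.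
have cE (u : R) (v w : C) : conjc (u%:C * v * conjc w) = u%:C * conjc v * w.
  by case: v w => [v1 v2] [w1 w2]; simpc; congr (_ +i* _); ring.
by rewrite cE (iT a c) (iT b d) mulrAC.
Qed.

End Calculus.

(** A chart takes values in C^n = R^(n + n).  Tensor fields are given by their
    components in every chart, as functions on (the image of) the chart, subject
    to the usual transformation laws. *)

Record complexManifold (R : realType) (n : nat) := ComplexManifold {
  mspace :> topologicalType;
  mspace_hausdorff : hausdorff_space mspace;
  chart_index : Type;
  dom : chart_index -> set mspace;
  coord : chart_index -> mspace -> 'rV[R]_(n + n);
  (* inverse of [coord i], meaningful on the image of [dom i] only *)
  point : chart_index -> 'rV[R]_(n + n) -> mspace;
  dom_open : forall i, open (dom i);
  dom_cover : forall p, exists i, dom i p;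
  coordK : forall i p, dom i p -> point i (coord i p) = p;
  image_open : forall i, open (coord i @` dom i);
  coord_continuous : forall i p, dom i p -> {for p, continuous (coord i)};
  point_continuous : forall i x,
    (coord i @` dom i) x -> {for x, continuous (point i)};
  transition_smooth : forall i j,
    smooth_mx (coord i @` (dom i `&` dom j)) (coord j \o point i);
  (* Cauchy-Riemann equations *)
  transition_holomorphic : forall i j x, (coord i @` (dom i `&` dom j)) x ->
    cplxJ R n *m jacobian (coord j \o point i) x
    = jacobian (coord j \o point i) x *m cplxJ R n
}.

Arguments dom {R n M} : rename.
Arguments coord {R n M} : rename.
Arguments point {R n M} : rename.

Section Manifold.
Variables (R : realType) (n : nat) (M : complexManifold R n).
Local Notation E := 'rV[R]_(n + n).
Local Notation C := R[i].
Local Notation chart := (chart_index M).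

Definition chart_image (i : chart) (U : set M) : set E :=
  coord i @` (dom i `&` U).

Definition transition (i j : chart) : E -> E := coord j \o point i.

Definition smooth_on (U : set M) (f : M -> C) : Prop :=
  forall i : chart, smoothC (chart_image i U) (f \o point i).

Definition holomorphic_on (U : set M) (f : M -> C) : Prop :=
  forall i : chart, holomorphic (chart_image i U) (f \o point i).

(* Components θ_a = θ(∂_a) in each chart. *)
Record oneForm := OneForm {
  form_at :> chart -> E -> 'cV[R]_(n + n);
  form_smooth : forall i, smooth_mx (chart_image i setT) (form_at i);
  form_transition : forall i j x, chart_image i (dom j) x ->
    form_at i x = jacobian (transition i j) x *m form_at j (transition i j x)
}.

(* Components g_ab = g(∂_a, ∂_b) of the underlying Riemannian metric. *)
Record hermitianMetric := HermitianMetric {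
  metric_at :> chart -> E -> 'M[R]_(n + n);
  metric_smooth : forall i, smooth_mx (chart_image i setT) (metric_at i);
  metric_transition : forall i j x, chart_image i (dom j) x ->
    let J := jacobian (transition i j) x in
    metric_at i x = J *m metric_at j (transition i j x) *m J^T;
  metric_sym : forall i x, chart_image i setT x ->
    (metric_at i x)^T = metric_at i x;
  metric_pos : forall i x, chart_image i setT x ->
    forall v : E, v != 0 -> 0 < (v *m metric_at i x *m v^T) 0 0;
  metric_hermitian : forall i x, chart_image i setT x ->
    cplxJ R n *m metric_at i x *m (cplxJ R n)^T = metric_at i x
}.

(* Christoffel symbols: ∇_{∂_a} ∂_b = sum_c (conn_at i x a) b c ∂_c. *)
Record affineConnection := AffineConnection {
  conn_at :> chart -> E -> 'I_(n + n) -> 'M[R]_(n + n);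
  conn_smooth : forall i a,
    smooth_mx (chart_image i setT) (fun x => conn_at i x a);
  conn_transition : forall i j x, chart_image i (dom j) x ->
    let J := jacobian (transition i j) x in
    forall a, conn_at i x a *m J
      = pder a (jacobian (transition i j)) x
        + \sum_d J a d *: (J *m conn_at j (transition i j x) d)
}.

Definition torsion_free (D : affineConnection) : Prop :=
  forall i x, chart_image i setT x ->
  forall a b c, D i x a b c = D i x b a c.

(* (∇_{∂_a} g)(∂_b, ∂_c), as a matrix in (b, c). *)
Definition cov_metric (D : affineConnection) (g : hermitianMetric)
    (i : chart) (x : E) (a : 'I_(n + n)) : 'M[R]_(n + n) :=
  pder a (g i) x - D i x a *m g i x - g i x *m (D i x a)^T.

(* (∇_{∂_a} θ)(∂_b), as a column in b. *)
Definition cov_form (D : affineConnection) (theta : oneForm)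
    (i : chart) (x : E) (a : 'I_(n + n)) : 'cV[R]_(n + n) :=
  pder a (theta i) x - D i x a *m theta i x.

(* ∇I = 0; the matrix of I is constant in holomorphic coordinates. *)
Definition parallel_complex_structure (D : affineConnection) : Prop :=
  forall i x, chart_image i setT x ->
  forall a, cplxJ R n *m D i x a = D i x a *m cplxJ R n.

Definition closed_form (theta : oneForm) : Prop :=
  forall i x, chart_image i setT x ->
  forall a b, pder a (theta i) x b 0 = pder b (theta i) x a 0.

Definition is_LCK (g : hermitianMetric) (theta : oneForm) : Prop :=
  closed_form theta /\
  exists D : affineConnection,
    [/\ torsion_free D,
        forall i x, chart_image i setT x ->
          forall a, cov_metric D g i x a = theta i x a 0 *: g i x
      & parallel_complex_structure D].

Definition levi_civita (g : hermitianMetric) (D : affineConnection) : Prop :=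
  torsion_free D /\
  (forall i x, chart_image i setT x -> forall a, cov_metric D g i x a = 0).

Definition unit_length (g : hermitianMetric) (theta : oneForm) : Prop :=
  forall i x, chart_image i setT x ->
    ((theta i x)^T *m invmx (g i x) *m theta i x) 0 0 = 1.

Definition is_Vaisman (g : hermitianMetric) (theta : oneForm) : Prop :=
  [/\ is_LCK g theta,
      exists D : affineConnection, levi_civita g D /\
        (forall i x, chart_image i setT x -> forall a, cov_form D theta i x a = 0)
    & unit_length g theta].

Definition omega0 (theta : oneForm) (i : chart) (x : E) : 'M[C]_(n + n) :=
  dc1 (fun y a => (theta i y a 0)%:C) x.

(* The adjoint of [f |-> f omega0], see [Lambda0_adjoint]. *)
Definition Lambda0 (g : hermitianMetric) (theta : oneForm) (i : chart) (x : E)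
    (eta : 'M[C]_(n + n)) : C :=
  form2_dot (g i x) eta (omega0 theta i x).

Lemma Lambda0_adjoint (g : hermitianMetric) (theta : oneForm) i x f eta :
  chart_image i setT x ->
  form2_dot (g i x) (f *: omega0 theta i x) eta
  = f * conjc (Lambda0 g theta i x eta).
Proof.
move=> /(metric_sym g) gT; rewrite /Lambda0 -(form2_dotC _ _ gT) /form2_dot.
rewrite mulrCA; congr (_ * _); rewrite mulr_sumr.
do 4!(apply: eq_bigr => ? _; rewrite ?mulr_sumr).
by rewrite mxE; ring.
Qed.

(* [eta a b] is the matrix of the endomorphism eta(∂_a, ∂_b). *)
Definition Lambda0_end r (g : hermitianMetric) (theta : oneForm)
    (i : chart) (x : E) (eta : 'I_(n + n) -> 'I_(n + n) -> 'M[C]_r) : 'M[C]_r :=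
  \matrix_(k, l) Lambda0 g theta i x (\matrix_(a, b) eta a b k l).

(** A holomorphic vector bundle of rank r is given by its fibers and by local
    trivializations, linear on fibers and with holomorphic transition functions;
    these determine the total space. *)

Record holomorphicBundle (r : nat) := HolomorphicBundle {
  fiber :> M -> lmodType C;
  triv_index : Type;
  tdom : triv_index -> set M;
  triv : forall (k : triv_index) (p : M), {linear fiber p -> 'rV[C]_r};
  (* inverse of [triv k p], meaningful for p in [tdom k] only *)
  frame : forall (k : triv_index) (p : M), 'rV[C]_r -> fiber p;
  tdom_open : forall k, open (tdom k);
  tdom_cover : forall p, exists k, tdom k p;
  trivK : forall k p, tdom k p -> cancel (triv k p) (frame k p);
  frameK : forall k p, tdom k p -> cancel (frame k p) (triv k p);
  triv_holomorphic : forall k l a b, holomorphic_on (tdom k `&` tdom l)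
    (fun p => triv l p (frame k p (delta_mx 0 a)) 0 b)
}.

Arguments triv {r} _ _ _.
Arguments frame {r} _ _ _ _.

Section Bundle.
Variables (r : nat) (B : holomorphicBundle r).
Local Notation triv_of := (triv_index B).

Definition holomorphic_section (s : forall p : M, B p) : Prop :=
  forall (k : triv_of) (b : 'I_r),
    holomorphic_on (tdom k) (fun p => triv B k p (s p) 0 b).

Record hermitianStructure := HermitianStructure {
  herm :> forall p : M, B p -> B p -> C;
  herm_linear : forall p c (u v w : B p),
    herm (c *: u + v) w = c * herm u w + herm v w;
  herm_sym : forall p (u v : B p), herm v u = conjc (herm u v);
  herm_pos : forall p (u : B p), u != 0 -> 0 < herm u u;
  herm_smooth : forall (k : triv_of) (a b : 'I_r), smooth_on (tdom k)
    (fun p => herm (frame B k p (delta_mx 0 a)) (frame B k p (delta_mx 0 b)))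
}.

(* Gram matrix of the k-th frame, in the i-th chart. *)
Definition gram (h : hermitianStructure) (k : triv_of) (i : chart) (x : E) :
    'M[C]_r :=
  \matrix_(a, b) h (point i x) (frame B k (point i x) (delta_mx 0 a))
                               (frame B k (point i x) (delta_mx 0 b)).

Definition change_frame (k l : triv_of) (i : chart) (x : E) : 'M[C]_r :=
  \matrix_(a, b) triv B l (point i x)
                   (frame B k (point i x) (delta_mx 0 a)) 0 b.

(* Connection matrices: if e_1, .., e_r is the k-th frame, then
   ∇_{∂_a} e_b = sum_c (bconn_at k i x a) b c e_c; on coordinate rows this reads
   ∇_{∂_a} s = ∂_a s + s *m bconn_at k i x a. *)
Record bundleConnection := BundleConnection {
  bconn_at :> triv_of -> chart -> E -> 'I_(n + n) -> 'M[C]_r;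
  bconn_smooth : forall k i a,
    smoothC_mx (chart_image i (tdom k)) (fun x => bconn_at k i x a);
  bconn_transition : forall k i j x, chart_image i (dom j `&` tdom k) x ->
    forall a, bconn_at k i x a
      = \sum_d (jacobian (transition i j) x a d)%:C
               *: bconn_at k j (transition i j x) d;
  bconn_gauge : forall k l i x, chart_image i (tdom k `&` tdom l) x ->
    forall a, bconn_at k i x a *m change_frame k l i x
      = pderC a (change_frame k l i) x
        + change_frame k l i x *m bconn_at l i x a
}.

(* ∇^{0,1} = ∂̄: the connection matrices in holomorphic frames have type (1,0). *)
Definition compatible_holomorphic (D : bundleConnection) : Prop :=
  forall k i x, chart_image i (tdom k) x ->
  forall a, \sum_b (cplxJ R n a b)%:C *: D k i x b = 'i *: D k i x a.

(* d h(s, t) = h(∇s, t) + h(s, ∇t). *)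
Definition compatible_hermitian (h : hermitianStructure)
    (D : bundleConnection) : Prop :=
  forall k i x, chart_image i (tdom k) x ->
  forall a, pderC a (gram h k i) x
    = D k i x a *m gram h k i x
      + gram h k i x *m (map_mx conjc (D k i x a))^T.

Definition chern_connection (h : hermitianStructure)
    (D : bundleConnection) : Prop :=
  compatible_holomorphic D /\ compatible_hermitian h D.

(* [∇_{∂_a}, ∇_{∂_b}], acting on coordinate rows in the k-th frame by right
   multiplication; whence the order of the factors. *)
Definition curvature (D : bundleConnection) (k : triv_of) (i : chart) (x : E)
    (a b : 'I_(n + n)) : 'M[C]_r :=
  pderC a (fun y => D k i y b) x - pderC b (fun y => D k i y a) x
  + D k i x b *m D k i x a - D k i x a *m D k i x b.

(* The endomorphism sqrt(-1) Λ_0(Θ_B) of the fiber at p, computed in the k-th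
   frame and the i-th chart. *)
Definition iLambda0_curvature (g : hermitianMetric) (theta : oneForm)
    (D : bundleConnection) (k : triv_of) (i : chart) (p : M) (u : B p) : B p :=
  frame B k p (triv B k p u *m
    ('i *: Lambda0_end g theta i (coord i p) (curvature D k i (coord i p)))).

(* The order of R[i] makes [z < 0] entail that z is real. *)
Definition strictly_negative_curvature (g : hermitianMetric) (theta : oneForm)
    (h : hermitianStructure) (D : bundleConnection) : Prop :=
  forall k i p, tdom k p -> dom i p ->
  forall u : B p, u != 0 ->
    h p (iLambda0_curvature g theta D k i u) u < 0.

End Bundle.
End Manifold.

(* Main.v *)
Require Import Defs.
From mathcomp Require Import all_boot all_order all_algebra.
From mathcomp Require Import all_classical all_reals all_analysis.
From mathcomp Require Import complex ring lra.

(** At a maximum point x of |s|^2 work in one chart and one holomorphic frame.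
    Comparing the Weyl connection of the LCK structure with the Levi-Civita
    connection, for which the Lee form is parallel, gives
    omega_0 = G (J Q) G at x, where G is the metric and Q is the cometric
    projected off the plane of theta and theta o J.  So Q is positive
    semidefinite and J-invariant, and Lambda_0 is half the contraction with
    J Q.  Contracting the Hessian of |s|^2 with Q gives
    -2 <i Lambda_0(Theta) s, s> + 2 sum_ab Q_ab <nabla_a s, nabla_b s>.
    If s(x) <> 0 this is positive, which contradicts maximality. *)

Set Implicit Arguments.
Unset Strict Implicit.
Unset Printing Implicit Defensive.

Import Order.TTheory GRing.Theory Num.Theory.
Import numFieldNormedType.Exports.

Local Open Scope classical_set_scope.
Local Open Scope ring_scope.
Local Open Scope complex_scope.

(** * Linear algebra of the Lee form *)

(** The Levi-Civita connection makes the Lee form parallel but in general does not commute with J;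
    the Weyl connection commutes with J but does not make it parallel. Their difference is explicit
    in theta and the metric, so the derivative of theta can be written with the Weyl connection,
    whose contribution to J(d theta) is symmetric and therefore disappears in d^c theta. The matrix
    Q is frozen at the maximum point, so no derivative of the metric of M enters the Hessian. Being
    J-invariant, Q sees only the J-invariant part of the Hessian, which is governed by the mixed
    derivatives in z and its conjugate; hence plain partial derivatives in one holomorphic chart
    suffice and no Christoffel symbols of M appear in the Bochner formula. Q is degenerate along the
    plane of the Lee form, so the gradient term is only nonnegative; the strict sign comes from the
    curvature term. *)

Lemma cplxJ_sqr (R : realType) n : cplxJ R n *m cplxJ R n = - 1%:M.
Proof.
rewrite /cplxJ mulmx_block !mul0mx !mulmx0 !mul1mx !mulmx1 !add0r !addr0.
by rewrite -[1%:M in RHS]/(1%:M) scalar_mx_block opp_block_mx oppr0.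
Qed.

Lemma cplxJ_tr (R : realType) n : (cplxJ R n)^T = - cplxJ R n.
Proof.
by rewrite /cplxJ tr_block_mx !trmx0 raddfN /= trmx1 opp_block_mx oppr0 opprK.
Qed.

(** Cholesky factorization, one pivot at a time: the Schur complement [C - a^-1 *: (b^T *m b)] is
    again positive semidefinite. A zero pivot forces its row [b] to vanish, and the same formulas
    then hold with inverses of 0 equal to 0. *)
Lemma psd_factor (R : rcfType) m (Q : 'M[R]_m) : Q^T = Q ->
  (forall v : 'rV_m, 0 <= (v *m Q *m v^T) 0 0) ->
  exists V : 'M[R]_m, Q = V^T *m V.
Proof.
elim: m Q => [|m IH] Q QT Q_ge0; first by exists 0; rewrite [LHS]flatmx0 [RHS]flatmx0.
pose a : R := Q 0 0; pose b : 'rV_m := @ursubmx _ 1 m 1 m Q.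
pose C : 'M[R]_m := @drsubmx _ 1 m 1 m Q.
have QE : Q = @block_mx _ 1 m 1 m a%:M b b^T C.
  rewrite -[LHS](@submxK _ 1 m 1 m); congr (@block_mx _ 1 m 1 m _ _ _ _).
    by apply/matrixP => i j; rewrite !ord1 !mxE eqxx mulr1n; congr (Q _ _); apply/val_inj.
  by rewrite /b trmx_ursub QT.
have CT : C^T = C by rewrite /C trmx_drsub QT.
move: QE CT; clearbody a b C => QE CT.
have quad x (w : 'rV_m) : 0 <= x ^+ 2 * a + 2 * x * (b *m w^T) 0 0 + (w *m C *m w^T) 0 0.
  have := Q_ge0 (@row_mx _ 1 1 m x%:M w).
  rewrite QE (@mul_row_block _ 1 1 m 1 m) (@tr_row_mx _ 1 1 m) (@mul_row_col _ 1 1 m).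
  rewrite tr_scalar_mx !mulmxDl -!scalar_mxM !mul_scalar_mx -!scalemxAl mul_mx_scalar.
  have -> : w *m b^T = b *m w^T.
    by rewrite -[LHS]trmxK trmx_mul trmxK; apply/matrixP=> i j; rewrite !ord1 mxE.
  by rewrite !mxE eqxx !mulr1n; congr (_ <= _); ring.
have a_ge0 : 0 <= a.
  by have := quad 1 0; rewrite trmx0 !mulmx0 mxE expr1n mul1r mulr0 !addr0.
have b_eq0 : a = 0 -> b = 0.
  move=> a0; have bb x : 0 <= 2 * x * (b *m b^T) 0 0 + (b *m C *m b^T) 0 0.
    by have := quad x b; rewrite a0 mulr0 add0r.
  set s := (b *m b^T) 0 0 in bb; set c := (_ *m _) 0 0 in bb.
  have s0 : s = \sum_j b 0 j ^+ 2.
    by rewrite /s mxE; apply: eq_bigr => j _; rewrite mxE expr2.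
  have s_ge0 : 0 <= s by rewrite s0; apply: sumr_ge0 => j _; exact: sqr_ge0.
  have {}s_eq0 : s = 0.
    apply/eqP/negPn/negP => sN0.
    (* An affine function of x bounded below has slope zero: this x would give it the value -1. *)
    have := bb (- (c + 1) / (2 * s)).
    have -> : 2 * (- (c + 1) / (2 * s)) * s + c = - 1 by field.
    by rewrite lerNr oppr0 ler10.
  apply/rowP => j; rewrite mxE; apply/eqP; rewrite -sqrf_eq0.
  move/eqP: s_eq0; rewrite s0 psumr_eq0 => [/allP/(_ j)|i _]; last exact: sqr_ge0.
  by rewrite mem_index_enum => /(_ isT).
have [V VE] : exists V : 'M[R]_m, C - a^-1 *: (b^T *m b) = V^T *m V.
  apply: IH => [|w].
    by rewrite linearB linearZ /= trmx_mul trmxK CT.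
  have [a0|aN0] := eqVneq a 0.
    have := quad 0 w; rewrite a0 b_eq0 // mul0mx mxE mulr0 mulr0 addr0 add0r.
    by rewrite mulmx0 scaler0 subr0.
  (* The minimizer in x of the quadratic polynomial [quad]; its minimum is the value of the Schur
     complement at [w]. *)
  have := quad (- a^-1 * (b *m w^T) 0 0) w.
  have -> : (w *m (C - a^-1 *: (b^T *m b)) *m w^T) 0 0
            = (w *m C *m w^T) 0 0 - a^-1 * (b *m w^T) 0 0 ^+ 2.
    rewrite mulmxBr mulmxBl -scalemxAr -scalemxAl [LHS]mxE; congr (_ + _).
    have <- : (w *m b^T)^T = b *m w^T by rewrite trmx_mul trmxK.
    have -> : w *m (b^T *m b) *m w^T = (w *m b^T) *m (w *m b^T)^T.
      by rewrite trmx_mul trmxK !mulmxA.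
    move: (w *m b^T) => z; rewrite !mxE big_ord1 mxE -expr2; ring.
  set y := (b *m w^T) 0 0; move=> q; rewrite (le_trans q) // le_eqVlt.
  by apply/orP; left; apply/eqP; field.
exists (@block_mx _ 1 m 1 m (Num.sqrt a)%:M ((Num.sqrt a)^-1 *: b) 0 V).
rewrite (@tr_block_mx _ 1 m 1 m) (@mulmx_block _ 1 m 1 m 1 m) trmx0 !mul0mx mulmx0.
rewrite addr0 !addr0 tr_scalar_mx -scalar_mxM -expr2 sqr_sqrtr // -VE.
rewrite mul_scalar_mx scalerA mul_mx_scalar linearZ /= -scalemxAl -scalemxAr !scalerA.
rewrite -invfM -expr2 sqr_sqrtr // addrC subrK {1}QE.
have -> : (Num.sqrt a * (Num.sqrt a)^-1) *: b = b.
  have [/b_eq0->|aN0] := eqVneq a 0; first by rewrite scaler0.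
  by rewrite mulfV ?scale1r // sqrtr_eq0 -ltNge lt_neqAle eq_sym aN0.
have -> // : (Num.sqrt a * (Num.sqrt a)^-1) *: b^T = b^T.
have [/b_eq0->|aN0] := eqVneq a 0; first by rewrite trmx0 scaler0.
by rewrite mulfV ?scale1r // sqrtr_eq0 -ltNge lt_neqAle eq_sym aN0.
Qed.

Section LeeForm.
Variables (R : realFieldType) (m : nat) (G : 'M[R]_m) (th : 'cV[R]_m).
Hypotheses (GT : G^T = G) (Gu : G \in unitmx).
Hypothesis (th1 : (th^T *m invmx G *m th) 0 0 = 1).

(* [N] and [L] are the Weyl and the Levi-Civita connections; Koszul's cyclic
   permutation trick determines their difference from [th] and [G]. *)
Lemma weyl_levi_civita (dG N L : 'I_m -> 'M[R]_m) :
  (forall a b c, N a b c = N b a c) -> (forall a b c, L a b c = L b a c) ->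
  (forall a, dG a - N a *m G - G *m (N a)^T = th a 0 *: G) ->
  (forall a, dG a - L a *m G - G *m (L a)^T = 0) ->
  forall a, L a *m th = N a *m th + th a 0 *: th - 2^-1 *: (row a G)^T.
Proof.
move=> Nsym Lsym NG LG a.
(* The difference of the two connections with its upper index lowered. It is symmetric in its first
   two indices by torsion-freeness, and its symmetric part in the last two is prescribed by the Lee
   form. *)
pose B x := (N x - L x) *m G.
have Bsym x y z : B x y z = B y x z.
  by rewrite !mxE; apply: eq_bigr => k _; rewrite !mxE Nsym Lsym.
have BG x y z : B x y z = - (th x 0 * G y z) - B x z y.
  have : B x + (B x)^T = - (th x 0 *: G).
    rewrite -NG -[LHS]addr0 -[0 in LHS]oppr0 -[in LHS](LG x) /B trmx_mul GT.
    rewrite linearB /= mulmxBl mulmxBr.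
    by apply/matrixP => i j; rewrite !mxE; ring.
  by move=> /matrixP /(_ y z); rewrite !mxE => <-; ring.
have Gs x y : G x y = G y x by rewrite -{1}GT mxE.
have BE x y z : B x y z
    = - 2^-1 * (th x 0 * G y z + th y 0 * G x z - th z 0 * G x y).
  have := BG x y z; have := BG z x y; have := BG y z x.
  rewrite (Bsym x z y) (Bsym z y x) (Bsym y x z) (Gs z x) => *; lra.
have Bth : (N a - L a) *m th = B a *m (invmx G *m th).
  by rewrite /B -mulmxA mulKVmx.
have : (N a - L a) *m th = 2^-1 *: (row a G)^T - th a 0 *: th.
  rewrite Bth; apply/colP => b; rewrite mxE.
  (* The last index is contracted with the vector dual to [th]; unit length turns the third term
     into a multiple of [G a b] alone. *)
  transitivity (- 2^-1 * (th a 0 * (G *m (invmx G *m th)) b 0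
     + th b 0 * (G *m (invmx G *m th)) a 0
     - G a b * (th^T *m (invmx G *m th)) 0 0)).
    rewrite ![(_ *m (_ *m _)) _ 0]mxE !mulr_sumr -big_split -sumrB mulr_sumr /=.
    by apply: eq_bigr => k _; rewrite BE [th^T _ _]mxE; ring.
  by rewrite mulKVmx // [th^T *m _]mulmxA th1 !mxE; field.
move=> E; have -> : L a *m th = N a *m th - (N a - L a) *m th by rewrite mulmxBl subKr.
by rewrite E opprB addrA addrAC.
Qed.

Variable J : 'M[R]_m.
Hypotheses (JT : J^T = - J) (J2 : J *m J = - 1%:M) (JG : J *m G *m J^T = G).

Lemma J_commute : J *m G = G *m J.
Proof. by rewrite -{2}JG JT mulmxN mulNmx -!mulmxA J2 !mulmxN !mulmx1 opprK. Qed.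

Lemma J_commute_inv : J *m invmx G = invmx G *m J.
Proof.
by apply: (can_inj (mulKmx Gu)); rewrite !mulmxA mulmxV // mul1mx -J_commute mulmxK.
Qed.

(* The cometric, projected to the orthogonal complement of [th] and [J th]. *)
Definition transversal_cometric : 'M[R]_m :=
  let t := invmx G *m th in invmx G - t *m t^T - (J *m t) *m (J *m t)^T.

Lemma transversal_tr : transversal_cometric^T = transversal_cometric.
Proof.
rewrite /transversal_cometric; move: (invmx G *m th) (J *m _) => t s.
by rewrite !raddfB /= trmx_inv GT !trmx_mul !trmxK.
Qed.

Lemma transversal_commute : J *m transversal_cometric = transversal_cometric *m J.
Proof.
rewrite /transversal_cometric; move: (invmx G *m th) => t.
have JJt : J *m (J *m t) = - t by rewrite mulmxA J2 mulNmx mul1mx.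
have JtJ : (J *m t)^T *m J = t^T.
  by rewrite trmx_mul JT mulmxN mulNmx -mulmxA J2 mulmxN mulmx1 opprK.
have tJ : t^T *m J = - (J *m t)^T by rewrite trmx_mul JT mulmxN opprK.
rewrite !(mulmxBr J) !(mulmxBl _ _ J) J_commute_inv.
rewrite -[t *m t^T *m J]mulmxA -[_ *m (J *m t)^T *m J]mulmxA JtJ tJ.
by rewrite [J *m (t *m _)]mulmxA [J *m (J *m t *m _)]mulmxA JJt mulmxN mulNmx !opprK addrAC.
Qed.

(** The covectors [th] and [J *m th] are orthonormal for the cometric, so the form is the squared
    cometric norm of [u], the component of [v] orthogonal to both. *)
Lemma transversal_psd (v : 'rV[R]_m) :
  (forall w : 'rV[R]_m, w != 0 -> 0 < (w *m G *m w^T) 0 0) ->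
  0 <= (v *m transversal_cometric *m v^T) 0 0.
Proof.
move=> Gpos.
pose t := invmx G *m th.
pose x := (v *m t) 0 0; pose y := (v *m (J *m t)) 0 0.
pose u := v - x *: th^T - y *: (J *m th)^T.
have Gi : (invmx G)^T = invmx G by rewrite trmx_inv GT.
have E1 : th^T *m t = 1%:M.
  by apply/matrixP => i j; rewrite !ord1 mulmxA th1 mxE.
(* A 1 x 1 matrix is its own transpose, while [invmx G *m J] is antisymmetric. *)
have E2 : th^T *m (J *m t) = 0.
  have : (th^T *m (J *m t))^T = - (th^T *m (J *m t)).
    rewrite !trmx_mul trmxK Gi JT mulmxN mulNmx -[_ *m invmx G *m J]mulmxA.
    by rewrite -J_commute_inv /t !mulmxA.
  move=> /matrixP /(_ 0 0); rewrite mxE [in RHS]mxE => E.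
  by apply/matrixP => i j; rewrite !ord1 [RHS]mxE; lra.
have vt : v *m t = x%:M by apply/matrixP => i j; rewrite !ord1 [RHS]mxE mulr1n.
have vJt : v *m (J *m t) = y%:M by apply/matrixP => i j; rewrite !ord1 [RHS]mxE mulr1n.
have -> : v *m transversal_cometric *m v^T = u *m invmx G *m u^T.
  have tT : t^T = th^T *m invmx G by rewrite trmx_mul Gi.
  have JthG : (J *m th)^T *m invmx G = (J *m t)^T.
    by rewrite -{1}Gi -trmx_mul /t [J *m (_ *m _)]mulmxA J_commute_inv mulmxA.
  have uG : u *m invmx G = v *m invmx G - x *: t^T - y *: (J *m t)^T.
    by rewrite /u !mulmxBl -!scalemxAl JthG tT.
  have uT : u^T = v^T - x *: th - y *: (J *m th) by rewrite /u !linearB !linearZ /= !trmxK.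
  have tth : t^T *m th = 1%:M by rewrite -[LHS]trmxK trmx_mul trmxK E1 trmx1.
  have tJth : t^T *m (J *m th) = 0.
    by rewrite -E2 tT /t !mulmxA -[_ *m invmx G *m J]mulmxA -J_commute_inv mulmxA.
  have Jtth : (J *m t)^T *m th = 0 by rewrite -[LHS]trmxK trmx_mul trmxK E2 trmx0.
  have JtJth : (J *m t)^T *m (J *m th) = 1%:M.
    rewrite trmx_mul JT mulmxN mulNmx -mulmxA [J *m (J *m _)]mulmxA J2.
    by rewrite mulNmx mulmxN opprK mul1mx.
  have tv : t^T *m v^T = x%:M by rewrite -trmx_mul vt tr_scalar_mx.
  have Jtv : (J *m t)^T *m v^T = y%:M by rewrite -trmx_mul vJt tr_scalar_mx.
  have vGth : v *m invmx G *m th = x%:M by rewrite -mulmxA.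
  have vGJth : v *m invmx G *m (J *m th) = y%:M.
    by rewrite -vJt /t !mulmxA -[v *m J *m _]mulmxA J_commute_inv mulmxA.
  have vttv : v *m (t *m t^T) *m v^T = (x * x)%:M.
    by rewrite mulmxA vt -mulmxA tv scalar_mxM.
  have vssv : v *m (J *m t *m (J *m t)^T) *m v^T = (y * y)%:M.
    by rewrite mulmxA vJt -mulmxA Jtv scalar_mxM.
  rewrite uG uT /transversal_cometric -/t !(mulmxBl, mulmxBr) -!scalemxAl -!scalemxAr vttv vssv.
  rewrite tth tJth Jtth JtJth tv Jtv vGth vGJth.
  apply/matrixP => p q; rewrite !ord1 !mxE !mulr1n; ring.
(* The cometric norm of [u] is the metric norm of its dual vector. *)
have := Gpos (u *m invmx G).
have [-> _|uN0 /(_ isT)] := eqVneq (u *m invmx G) 0; first by rewrite mul0mx mxE.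
by rewrite mulmxKV // trmx_mul Gi mulmxA => /ltW.
Qed.

(* [dth a b] stands for the partial derivative of [th b] in the direction [a]. *)
Lemma dc_lee (dG N L : 'I_m -> 'M[R]_m) (dth : 'M[R]_m) :
  (forall a b c, N a b c = N b a c) -> (forall a b c, L a b c = L b a c) ->
  (forall a, dG a - N a *m G - G *m (N a)^T = th a 0 *: G) ->
  (forall a, dG a - L a *m G - G *m (L a)^T = 0) ->
  (forall a, J *m N a = N a *m J) ->
  (forall a b, dth a b = (L a *m th) b 0) ->
  (J *m dth)^T - J *m dth = G *m (J *m transversal_cometric) *m G.
Proof.
move=> Nsym Lsym NG LG NJ dthE.
have dE a b : dth a b = (N a *m th) b 0 + th a 0 * th b 0 - 2^-1 * G a b.
  by rewrite dthE (weyl_levi_civita Nsym Lsym NG LG) !mxE.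
pose H : 'M[R]_m := \matrix_(a, b) (N a *m th) b 0.
have HE : dth = H + th *m th^T - 2^-1 *: G.
  by apply/matrixP => a b; rewrite dE !mxE big_ord1 !mxE.
(* As [J] commutes with [N] and there is no torsion, both sides are the values of the symmetric [N]
   contracted with [J *m th]. This Weyl part of [dth] thus drops out of the antisymmetrization. *)
have HJ : J *m H = (J *m H)^T.
  have JH a b : (J *m H) a b = (N b *m (J *m th)) a 0.
    rewrite mulmxA -NJ -mulmxA !mxE; apply: eq_bigr => c _; congr (_ * _).
    by rewrite !mxE; apply: eq_bigr => d _; rewrite Nsym.
  by apply/matrixP => a b; rewrite [RHS]mxE !JH !mxE; apply: eq_bigr => c _; rewrite Nsym.
have JGT : (J *m G)^T = - (J *m G) by rewrite trmx_mul GT JT mulmxN J_commute.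
pose t := invmx G *m th.
have Gt : G *m t = th by rewrite /t mulKVmx.
have GJt : G *m (J *m t) = J *m th by rewrite mulmxA -J_commute -mulmxA Gt.
have JtG : (J *m t)^T *m G = (J *m th)^T by rewrite -GJt [RHS]trmx_mul GT.
have tG : t^T *m G = th^T by rewrite -[in RHS]Gt [RHS]trmx_mul GT.
have JJt : J *m (J *m t) = - t by rewrite mulmxA J2 mulNmx mul1mx.
have -> : G *m (J *m transversal_cometric) *m G = J *m G - (J *m th) *m th^T + th *m (J *m th)^T.
  rewrite /transversal_cometric -/t !(mulmxBr, mulmxBl).
  rewrite [J *m (t *m _)]mulmxA [J *m (J *m t *m _)]mulmxA JJt mulNmx mulmxN mulNmx opprK.
  rewrite [G *m (J *m t *m _)]mulmxA GJt [G *m (t *m _)]mulmxA Gt.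
  rewrite -[J *m th *m t^T *m G]mulmxA tG -[_ *m (J *m t)^T *m G]mulmxA JtG.
  by rewrite J_commute_inv mulmxA mulmxV // mul1mx.
(* Since [J *m G] is antisymmetric, its two halves add up; [th *m th^T] supplies the two rank-one
   terms. *)
rewrite HE !(mulmxBr, mulmxDr) -scalemxAr mulmxA.
rewrite [in X in X - _]linearB [in X in X - _]linearD /= -HJ linearZ /= JGT.
rewrite [in X in X - _]trmx_mul trmxK.
by apply/matrixP => a b; rewrite 8!mxE; rewrite !mxE; field.
Qed.

End LeeForm.

(** * Contractions with a J-invariant positive semidefinite cometric *)

Section Contractions.
Variables (R : realType) (m : nat) (J Q : 'M[R]_m).
Local Notation C := R[i].

(** [X] is complex linear in its second slot, so [J] moves from there onto [Q] at the price of a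
    factor [- 'i]. The resulting [J *m Q] is antisymmetric and sees only the antisymmetric part of
    [X], whence the factor 1/2. *)
Lemma sum_J_invariant (V : lmodType C) (X : 'I_m -> 'I_m -> V) :
  J^T = - J -> Q^T = Q -> J *m Q = Q *m J ->
  (forall a b, \sum_c (J b c)%:C *: X a c = 'i *: X a b) ->
  \sum_a \sum_b (Q a b)%:C *: X a b
  = - ('i / 2) *: \sum_a \sum_b ((J *m Q) a b)%:C *: (X a b - X b a).
Proof.
move=> JT QT JQ XJ.
have iV : - 'i * 'i = 1 :> C by simpc.
have XE a b : X a b = - 'i *: \sum_c (J b c)%:C *: X a c.
  by rewrite XJ scalerA iV scale1r.
have anti : (J *m Q)^T = - (J *m Q) by rewrite trmx_mul JT QT mulmxN JQ.
have E1 : \sum_a \sum_b (Q a b)%:C *: X a b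
          = - 'i *: \sum_a \sum_b ((J *m Q) a b)%:C *: X a b.
  rewrite scaler_sumr; apply: eq_bigr => a _.
  under eq_bigr do rewrite XE scalerA mulrC -scalerA.
  rewrite -scaler_sumr; congr (_ *: _).
  under eq_bigr do rewrite scaler_sumr.
  rewrite exchange_big; apply: eq_bigr => c _ /=.
  under eq_bigr do rewrite scalerA.
  rewrite -scaler_suml; congr (_ *: _); rewrite JQ mxE rmorph_sum /=.
  by apply: eq_bigr => b _; rewrite rmorphM.
have E2 : \sum_a \sum_b ((J *m Q) a b)%:C *: X b a
          = - \sum_a \sum_b ((J *m Q) a b)%:C *: X a b.
  rewrite exchange_big -sumrN; apply: eq_bigr => a _; rewrite -sumrN.
  apply: eq_bigr => b _ /=; rewrite -scaleNr -rmorphN.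
  by move/matrixP: anti => /(_ a b); rewrite mxE [in RHS]mxE => ->.
have -> : \sum_a \sum_b ((J *m Q) a b)%:C *: (X a b - X b a)
          = 2 *: \sum_a \sum_b ((J *m Q) a b)%:C *: X a b.
  under eq_bigr do under eq_bigr do rewrite scalerBr.
  under eq_bigr do rewrite sumrB.
  by rewrite sumrB E2 opprK scaler_nat mulr2n.
by rewrite E1 scalerA mulNr divfK // pnatr_eq0.
Qed.

(** Factoring [Q] as [V^T *m V] turns the double sum into a sum of squared [H]-norms, one for each
    row of [V]. *)
Lemma sum_psd_sesqui r (H : 'M[C]_r) (S : 'I_m -> 'rV[C]_r) :
  Q^T = Q -> (forall v : 'rV_m, 0 <= (v *m Q *m v^T) 0 0) ->
  (forall u : 'rV_r, 0 <= (u *m H *m (map_mx conjc u)^T) 0 0) ->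
  0 <= \sum_a \sum_b (Q a b)%:C * (S a *m H *m (map_mx conjc (S b))^T) 0 0.
Proof.
move=> QT /(psd_factor QT) [V ->] H_ge0.
have -> : \sum_a \sum_b ((V^T *m V) a b)%:C * (S a *m H *m (map_mx conjc (S b))^T) 0 0
  = \sum_k ((\sum_a (V k a)%:C *: S a) *m H
            *m (map_mx conjc (\sum_b (V k b)%:C *: S b))^T) 0 0.
  under eq_bigr do under eq_bigr do rewrite mxE rmorph_sum mulr_suml.
  under eq_bigr do rewrite exchange_big.
  rewrite exchange_big; apply: eq_bigr => k _ /=.
  rewrite mulmx_suml mulmx_suml summxE; apply: eq_bigr => a _.
  have -> : (map_mx conjc (\sum_b (V k b)%:C *: S b))^T
    = \sum_b (V k b)%:C *: (map_mx conjc (S b))^T.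
    apply/matrixP => p q; rewrite mxE mxE summxE rmorph_sum summxE.
    by apply: eq_bigr => b _; rewrite !mxE rmorphM /= oppr0.
  rewrite mulmx_sumr summxE; apply: eq_bigr => b _.
  by rewrite -!scalemxAl -scalemxAr scalerA [RHS]mxE [V^T _ _]mxE rmorphM.
by apply: sumr_ge0 => k _.
Qed.

End Contractions.

(** [form2_dot] raises both indices of its second argument, which cancels the two factors [G]; the
    conjugation is harmless on a real matrix. *)
Lemma form2_dot_contract (R : realType) n (G P : 'M[R]_(n + n)) (eta : 'M[R[i]]_(n + n)) :
  G^T = G -> G \in unitmx ->
  form2_dot G eta (map_mx (fun x => x%:C) (G *m P *m G))
  = 2^-1 * \sum_a \sum_b (P a b)%:C * eta a b.
Proof.
move=> GT Gu; rewrite /form2_dot; congr (_ * _).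
apply: eq_bigr => a _; apply: eq_bigr => b _.
set W := G *m P *m G.
have -> : P = invmx G *m W *m (invmx G)^T.
  by rewrite trmx_inv GT /W !mulmxA mulVmx // mul1mx mulmxK.
rewrite mxE rmorph_sum mulr_suml exchange_big; apply: eq_bigr => d _ /=.
rewrite [(_ *m _) a d]mxE [_^T d b]mxE mulr_suml rmorph_sum mulr_suml.
apply: eq_bigr => c _; rewrite [map_mx _ _ _ _]mxE conjc_real !rmorphM /=; ring.
Qed.

(** * Second derivatives *)

Section RealCalculus.
Variables (R : realType) (V : normedModType R).
Implicit Types (f : V -> R) (x u v : V).

Lemma is_derive_line f x u (s : R) : derivable f (x + s *: u) u ->
  is_derive s 1 (fun t : R => f (x + t *: u)) ('D_u f (x + s *: u)).
Proof.
move=> df.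
have E : (fun h : R =>
           h^-1 *: (((fun t => f (x + t *: u)) \o shift s) (h *: (1 : R)) - f (x + s *: u)))
       = (fun h => h^-1 *: ((f \o shift (x + s *: u)) (h *: u) - f (x + s *: u))).
  apply/funext => h /=; congr (_ *: (f _ - _)).
  by rewrite [_%:A]mulr1 scalerDl addrCA.
by split; rewrite /derivable /derive E.
Qed.

(** The mean value theorem is applied twice: to [phi], the increment along [v] as a function of the
    step along [u], and then to ['D_u f] along [v]. *)
Lemma second_difference f x u v (h : R) : 0 < h ->
  (forall s t, 0 <= s <= h -> 0 <= t <= h ->
     differentiable f (x + s *: u + t *: v) /\
     differentiable ('D_u f) (x + s *: u + t *: v)) ->
  exists c d, [/\ 0 <= c <= h, 0 <= d <= h &
    f (x + h *: u + h *: v) - f (x + h *: u) - (f (x + h *: v) - f x)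
    = h * h * 'D_v ('D_u f) (x + c *: u + d *: v)].
Proof.
move=> h0 df.
pose phi s := f (x + h *: v + s *: u) - f (x + s *: u).
pose dphi s := 'D_u f (x + h *: v + s *: u) - 'D_u f (x + s *: u).
have hh : 0 <= h <= h by rewrite lexx ltW.
have h00 : (0 : R) <= 0 <= h by rewrite lexx ltW.
have dphiP s : 0 <= s <= h -> is_derive s 1 phi (dphi s).
  move=> hs; apply: is_deriveB; apply: is_derive_line; apply: diff_derivable.
    by rewrite addrAC; have [] := df s h hs hh.
  by have [] := df s 0 hs h00; rewrite scale0r addr0.
have [||c c_in Ec] := @MVT R phi dphi 0 h h0.
- by move=> s; rewrite in_itv /= => /andP[s0 sh]; apply: dphiP; rewrite !ltW.
- apply: derivable_within_continuous => s; rewrite in_itv /= => hs.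
  by have [] := dphiP s hs.
have hc : 0 <= c <= h by move: c_in; rewrite in_itv /= => /andP[? ?]; rewrite !ltW.
pose psi t := 'D_u f (x + c *: u + t *: v).
pose dpsi t := 'D_v ('D_u f) (x + c *: u + t *: v).
have dpsiP t : 0 <= t <= h -> is_derive t 1 psi (dpsi t).
  by move=> ht; apply: is_derive_line; apply: diff_derivable; have [] := df c t hc ht.
have [||d d_in Ed] := @MVT R psi dpsi 0 h h0.
- by move=> s; rewrite in_itv /= => /andP[s0 sh]; apply: dpsiP; rewrite !ltW.
- apply: derivable_within_continuous => t; rewrite in_itv /= => ht.
  by have [] := dpsiP t ht.
exists c, d; split => //; first by move: d_in; rewrite in_itv /= => /andP[? ?]; rewrite !ltW.
have := Ec; rewrite /phi subr0 scale0r !addr0 (addrAC x) => ->.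
have := Ed; rewrite /psi /dpsi subr0 scale0r !addr0 /dphi (addrAC x) => ->.
by ring.
Qed.

End RealCalculus.

Section SecondDerivatives.
Variables (R : realType) (V : normedModType R).
Implicit Types (f : V -> R) (x u v : V).

(** The second difference over a small parallelogram is symmetric in [u] and [v], and equals [h * h]
    times either mixed derivative at some point of the parallelogram. The two values thus coincide
    at points near x, and continuity brings them to x. *)
Lemma derive_comm f x u v :
  (\forall y \near x, differentiable f y) ->
  (\forall y \near x, differentiable ('D_u f) y) ->
  (\forall y \near x, differentiable ('D_v f) y) ->
  {for x, continuous ('D_v ('D_u f))} -> {for x, continuous ('D_u ('D_v f))} ->
  'D_v ('D_u f) x = 'D_u ('D_v f) x.
Proof.
move=> df duf dvf cuv cvu; apply/eqP; rewrite -subr_eq0 -normr_le0.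
apply/ler_addgt0Pr => e e0; rewrite add0r.
have e2 : 0 < e / 2 by rewrite divr_gt0.
have near_cont (F : V -> R) : {for x, continuous F} ->
    nbhs x [set y | `|F x - F y| <= e / 2].
  move=> cF; have := cF _ (nbhsx_ballx (F x) _ e2); rewrite -ball_normE.
  by apply: (@filterS _ _ (nbhs_filter x)) => y /ltW.
have {}cuv := near_cont _ cuv; have {}cvu := near_cont _ cvu.
have [r /= r0 Br] : exists2 r : R, 0 < r & forall y, `|x - y| < r ->
    [/\ differentiable f y, differentiable ('D_u f) y, differentiable ('D_v f) y,
     `|'D_v ('D_u f) x - 'D_v ('D_u f) y| <= e / 2 &
     `|'D_u ('D_v f) x - 'D_u ('D_v f) y| <= e / 2].
  have fI := @filterI _ _ (nbhs_filter x).
  have /nbhs_ballP[r /= r0 B] := fI _ _ df (fI _ _ duf (fI _ _ dvf (fI _ _ cuv cvu))).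
  exists r => // y xy; have := B y; rewrite -ball_normE => /(_ xy).
  move=> [b1 [b2 [b3 [b4 b5]]]].
  by split; [exact: b1|exact: b2|exact: b3|exact: b4|exact: b5].
(* The summand 1 keeps [k] positive when both directions vanish; [h * k = r / 2] keeps the
   parallelogram inside the ball of radius [r]. *)
pose k := `|u| + `|v| + 1; have k0 : 0 < k by rewrite ltr_wpDl // addr_ge0.
pose h := r / 2 / k; have h0 : 0 < h by rewrite !divr_gt0.
have near_x s t a b : `|a| + `|b| <= k -> 0 <= s <= h -> 0 <= t <= h ->
    `|x - (x + s *: a + t *: b)| < r.
  move=> abk /andP[s0 sh] /andP[t0 th].
  have -> : x - (x + s *: a + t *: b) = - (s *: a + t *: b).
    by rewrite -addrA opprD addrA subrr add0r.
  rewrite normrN (le_lt_trans (ler_normD _ _)) // !normrZ.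
  rewrite !ger0_norm // (@le_lt_trans _ _ (h * k)) //; last first.
    by rewrite /h divfK ?gt_eqF // ltr_pdivrMr // ltr_pMr // ltr1n.
  apply: le_trans (ler_wpM2l (ltW h0) abk); rewrite mulrDr.
  by rewrite lerD // ler_wpM2r.
have uvk : `|u| + `|v| <= k by rewrite lerDl.
have vuk : `|v| + `|u| <= k by rewrite addrC.
have [|c [d [hc hd E1]]] := @second_difference R V f x u v h h0.
  move=> s t hs ht; have [b1 b2 _ _ _] := Br _ (near_x s t u v uvk hs ht).
  by split; [exact: b1|exact: b2].
have [|c' [d' [hc' hd' E2]]] := @second_difference R V f x v u h h0.
  move=> s t hs ht; have [b1 _ b3 _ _] := Br _ (near_x s t v u vuk hs ht).
  by split; [exact: b1|exact: b3].
have E : 'D_v ('D_u f) (x + c *: u + d *: v) = 'D_u ('D_v f) (x + c' *: v + d' *: u).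
  apply: (@mulfI _ (h * h)); first by rewrite mulf_neq0 // gt_eqF.
  apply: etrans (esym E1) (etrans _ E2); rewrite (addrAC x (h *: v) (h *: u)) !opprB.
  by rewrite [LHS]addrACA [RHS]addrACA; congr (_ + _); exact: addrC.
have [_ _ _ B1 _] := Br _ (near_x _ _ _ _ uvk hc hd).
have [_ _ _ _ B2] := Br _ (near_x _ _ _ _ vuk hc' hd').
move: B1 B2; rewrite E; clear.
move: ('D_v ('D_u f) x) ('D_u ('D_v f) x) ('D_u ('D_v f) _) => p q z pz qz.
by rewrite [leRHS]splitr (le_trans (ler_distD z _ _)) // lerD // distrC.
Qed.

(** At a maximum ['D_v f] vanishes. Were its derivative positive, ['D_v f] would be positive just
    after x on the line, and the mean value theorem would produce a value of [f] larger than
    [f x]. *)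
Lemma derive2_local_max f x v :
  (\forall y \near x, differentiable f y) -> derivable ('D_v f) x v ->
  (\forall y \near x, f y <= f x) -> 'D_v ('D_v f) x <= 0.
Proof.
move=> df ddf fmax; rewrite leNgt; apply/negP => pos.
have line_near (P : set V) : nbhs x P ->
    exists2 d : R, 0 < d & forall t : R, `|t| < d -> P (x + t *: v).
  move=> Px; have : (fun t : R => x + t *: v) t @[t --> (0 : R)] --> x.
    rewrite -[X in _ --> X](addr0 x) -(scale0r v).
    by apply: cvgD; [exact: cvg_cst|apply: cvgZr_tmp; exact: cvg_id].
  move=> /(_ _ Px) /nbhs_ballP[d /= d0 dP]; exists d => // t td.
  by apply: dP; rewrite -ball_normE /= sub0r normrN.
have [d d0 dP] := line_near _ (@filterI _ _ (nbhs_filter x) _ _ df fmax).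
pose g t := f (x + t *: v).
have gP (t : R) : `|t| < d -> is_derive t 1 g ('D_v f (x + t *: v)).
  by move=> td; apply: is_derive_line; apply: diff_derivable; have [] := dP t td.
have crit : 'D_v f x = 0.
  have g0 : is_derive (0 : R) 1 g 0.
    apply: (@derive1_at_max _ g (- d) d) => [|t||t].
    - by rewrite ge0_cp // ltW.
    - by rewrite in_itv /= -ltr_norml => /gP [].
    - by rewrite in_itv /= oppr_lt0 d0.
    - rewrite in_itv /= -ltr_norml => /dP [_].
      by rewrite /g scale0r addr0.
  have : is_derive (0 : R) 1 g ('D_v f (x + 0 *: v)) by apply: gP; rewrite normr0.
  by rewrite scale0r addr0 => -[_ <-]; case: g0.
have : (fun h => h^-1 *: ('D_v f (h *: v + x) - 'D_v f x)) @ 0^' --> 'D_v ('D_v f) x.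
  exact: ddf.
move=> /cvgrPdist_lt /(_ _ pos); rewrite near_withinE => /nbhs_ballP[e /= e0 eP].
have incr (h : R) : 0 < h -> h < e -> 0 < 'D_v f (x + h *: v).
  move=> h0 he; have := eP h; rewrite -ball_normE /= sub0r normrN gtr0_norm // => /(_ he).
  rewrite gt_eqF // crit subr0 => /(_ isT).
  by rewrite ltr_distlC subrr addrC => /andP[+ _]; rewrite pmulr_rgt0 // invr_gt0.
pose m := Num.min d e / 2.
have m0 : 0 < m by rewrite divr_gt0 // lt_min d0.
have mm : m < Num.min d e by rewrite ltr_pdivrMr // ltr_pMr ?ltr1n // lt_min d0.
move: mm; rewrite lt_min => /andP[md me].
have in_d (t : R) : 0 <= t <= m -> `|t| < d.
  by move=> /andP[t0 tm]; rewrite ger0_norm // (le_lt_trans tm).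
have [||c c_in Ec] := @MVT R g (fun t => 'D_v f (x + t *: v)) 0 m m0.
- by move=> t; rewrite in_itv /= => /andP[t0 tm]; apply/gP/in_d; rewrite !ltW.
- apply: derivable_within_continuous => t; rewrite in_itv /= => ht.
  by have [] := gP t (in_d t ht).
have [_] : differentiable f (x + m *: v) /\ f (x + m *: v) <= f x.
  by apply: dP; rewrite gtr0_norm.
move: Ec; rewrite /g scale0r addr0 subr0 -subr_le0 => ->; apply/negP; rewrite -ltNge.
move: c_in; rewrite in_itv /= => /andP[c0 cm].
by rewrite mulr_gt0 // incr // (lt_trans cm).
Qed.

End SecondDerivatives.

(** * Complex-valued functions *)

Section ComplexCalculus.
Variables (R : realType) (n : nat).
Local Notation E := 'rV[R]_(n + n).
Local Notation C := R[i].
Implicit Types (f g : E -> C) (x v : E).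

Definition diffC f x := differentiable (fun y => complex.Re (f y)) x /\
  differentiable (fun y => complex.Im (f y)) x.

Lemma ReD (z w : C) : complex.Re (z + w) = complex.Re z + complex.Re w.
Proof. by case: z w => [? ?] [? ?]. Qed.

Lemma ImD (z w : C) : complex.Im (z + w) = complex.Im z + complex.Im w.
Proof. by case: z w => [? ?] [? ?]. Qed.

Lemma ReM (z w : C) : complex.Re (z * w)
  = complex.Re z * complex.Re w - complex.Im z * complex.Im w.
Proof. by case: z w => [? ?] [? ?]. Qed.

Lemma ImM (z w : C) : complex.Im (z * w)
  = complex.Re z * complex.Im w + complex.Im z * complex.Re w.
Proof. by case: z w => [? ?] [? ?]. Qed.

Lemma diffC_cst (c : C) x : diffC (fun=> c) x.
Proof. by split; exact: differentiable_cst. Qed.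

Lemma diffCD f g x : diffC f x -> diffC g x -> diffC (fun y => f y + g y) x.
Proof.
move=> [f1 f2] [g1 g2]; split.
  under eq_fun do rewrite ReD; exact: differentiableD f1 g1.
under eq_fun do rewrite ImD; exact: differentiableD f2 g2.
Qed.

Lemma diffCM f g x : diffC f x -> diffC g x -> diffC (fun y => f y * g y) x.
Proof.
move=> [f1 f2] [g1 g2]; split.
  under eq_fun do rewrite ReM.
  exact: differentiableB (differentiableM f1 g1) (differentiableM f2 g2).
under eq_fun do rewrite ImM.
exact: differentiableD (differentiableM f1 g2) (differentiableM f2 g1).
Qed.

Lemma diffC_conj f x : diffC f x -> diffC (fun y => conjc (f y)) x.
Proof.
move=> [f1 f2]; split.
  have -> : (fun y => complex.Re (conjc (f y))) = (fun y => complex.Re (f y)).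
    by apply/funext => y; case: (f y).
  exact: f1.
have -> : (fun y => complex.Im (conjc (f y))) = (- (fun y => complex.Im (f y))).
  by apply/funext => y /=; rewrite fctE /=; case: (f y).
exact: differentiableN f2.
Qed.

Lemma diffC_sum (I : Type) (s : seq I) (F : I -> E -> C) x :
  (forall i, diffC (F i) x) -> diffC (fun y => \sum_(i <- s) F i y) x.
Proof.
move=> dF; elim: s => [|i s IH].
  under eq_fun do rewrite big_nil; exact: diffC_cst.
under eq_fun do rewrite big_cons; exact: diffCD (dF i) IH.
Qed.

Lemma derCD v f g x : diffC f x -> diffC g x ->
  derC v (fun y => f y + g y) x = derC v f x + derC v g x.
Proof.
move=> [/(diff_derivable (v := v)) f1 /(diff_derivable (v := v)) f2].
move=> [/(diff_derivable (v := v)) g1 /(diff_derivable (v := v)) g2]; rewrite /derC.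
under eq_fun do rewrite ReD; under [X in _ +i* 'D_v X x]eq_fun do rewrite ImD.
by congr (_ +i* _); [exact: deriveD f1 g1|exact: deriveD f2 g2].
Qed.

Lemma derCM v f g x : diffC f x -> diffC g x ->
  derC v (fun y => f y * g y) x = derC v f x * g x + f x * derC v g x.
Proof.
move=> [/(diff_derivable (v := v)) f1 /(diff_derivable (v := v)) f2].
move=> [/(diff_derivable (v := v)) g1 /(diff_derivable (v := v)) g2]; rewrite /derC.
under eq_fun do rewrite ReM; under [X in _ +i* 'D_v X x]eq_fun do rewrite ImM.
have E1 := deriveB (derivableM f1 g1) (derivableM f2 g2).
have E2 := deriveD (derivableM f1 g2) (derivableM f2 g1).
rewrite (deriveM f1 g1) (deriveM f2 g2) in E1; rewrite (deriveM f1 g2) (deriveM f2 g1) in E2.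
move: ('D_v (fun y => complex.Re (f y)) x) ('D_v (fun y => complex.Im (f y)) x)
  ('D_v (fun y => complex.Re (g y)) x) ('D_v (fun y => complex.Im (g y)) x) E1 E2.
move=> a b c d E1 E2; transitivity (
  (complex.Re (f x) * c + complex.Re (g x) * a
   - (complex.Im (f x) * d + complex.Im (g x) * b)) +i*
  (complex.Re (f x) * d + complex.Im (g x) * a
   + (complex.Im (f x) * c + complex.Re (g x) * b))).
  by congr (_ +i* _); [exact: E1|exact: E2].
by case: (f x) (g x) => [k l] [s t] /=; simpc; congr (_ +i* _); ring.
Qed.

Lemma derC_conj v f x : diffC f x -> derC v (fun y => conjc (f y)) x = conjc (derC v f x).
Proof.
move=> [f1 f2]; rewrite /derC /=.
have -> : (fun y => complex.Re (conjc (f y))) = (fun y => complex.Re (f y)).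
  by apply/funext => y; case: (f y).
have -> : (fun y => complex.Im (conjc (f y))) = (- (fun y => complex.Im (f y))).
  by apply/funext => y /=; rewrite fctE /=; case: (f y).
by rewrite (deriveN (diff_derivable (v := v) f2)).
Qed.

Lemma derC_cst v (c : C) x : derC v (fun=> c) x = 0.
Proof. by rewrite /derC !derive_cst. Qed.

Lemma derC_sum v (I : Type) (s : seq I) (F : I -> E -> C) x :
  (forall i, diffC (F i) x) ->
  derC v (fun y => \sum_(i <- s) F i y) x = \sum_(i <- s) derC v (F i) x.
Proof.
move=> dF; elim: s => [|i s IH].
  rewrite big_nil; under eq_fun do rewrite big_nil; exact: derC_cst.
rewrite big_cons; under eq_fun do rewrite big_cons.
by rewrite derCD ?IH //; exact: diffC_sum.
Qed.

Lemma near_derC v f g x : (\near x, f x = g x) -> derC v f x = derC v g x.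
Proof.
move=> fg; rewrite /derC; congr (_ +i* _); apply: near_eq_derive.
  by apply: filterS fg => y ->.
by apply: filterS fg => y ->.
Qed.

Lemma derC_basis v f x : diffC f x ->
  derC v f x = \sum_b (v 0 b)%:C * derC (Defs.basis R b) f x.
Proof.
move=> [f1 f2]; rewrite /derC.
have lin (h : E -> R) : differentiable h x ->
    'D_v h x = \sum_b v 0 b * 'D_(Defs.basis R b) h x.
  move=> dh; rewrite deriveE // {1}(row_sum_delta v) linear_sum.
  by apply: eq_bigr => b _; rewrite linearZ deriveE.
rewrite (lin _ f1) (lin _ f2); apply/eqP.
rewrite eq_complex /= !raddf_sum /=.
by apply/andP; split; apply/eqP/eq_bigr => b _ /=; rewrite mul0r ?subr0 ?addr0.
Qed.

Section Matrices.
Implicit Types p q r : nat.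

Definition diffC_mx p q (F : E -> 'M[C]_(p, q)) x :=
  forall b c, diffC (fun y => F y b c) x.

Definition adj p q (A : 'M[C]_(p, q)) : 'M[C]_(q, p) := (map_mx conjc A)^T.

Lemma diffC_mxD p q (F G : E -> 'M[C]_(p, q)) x :
  diffC_mx F x -> diffC_mx G x -> diffC_mx (fun y => F y + G y) x.
Proof. by move=> dF dG b c; under eq_fun do rewrite mxE; exact: diffCD. Qed.

Lemma diffC_mxM p q r (F : E -> 'M[C]_(p, q)) (G : E -> 'M[C]_(q, r)) x :
  diffC_mx F x -> diffC_mx G x -> diffC_mx (fun y => F y *m G y) x.
Proof.
move=> dF dG b c; under eq_fun do rewrite mxE.
by apply: diffC_sum => k; exact: diffCM.
Qed.

Lemma diffC_adj p q (F : E -> 'M[C]_(p, q)) x :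
  diffC_mx F x -> diffC_mx (fun y => adj (F y)) x.
Proof. by move=> dF b c; under eq_fun do rewrite !mxE; exact: diffC_conj. Qed.

Lemma pderCD p q a (F G : E -> 'M[C]_(p, q)) x :
  diffC_mx F x -> diffC_mx G x ->
  pderC a (fun y => F y + G y) x = pderC a F x + pderC a G x.
Proof.
move=> dF dG; apply/matrixP => b c; rewrite !mxE.
by under eq_fun do rewrite mxE; exact: derCD.
Qed.

Lemma pderCM p q r a (F : E -> 'M[C]_(p, q)) (G : E -> 'M[C]_(q, r)) x :
  diffC_mx F x -> diffC_mx G x ->
  pderC a (fun y => F y *m G y) x = pderC a F x *m G x + F x *m pderC a G x.
Proof.
move=> dF dG; apply/matrixP => b c; rewrite !mxE.
under eq_fun do rewrite mxE; rewrite derC_sum => [|k]; last exact: diffCM.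
by rewrite -big_split; apply: eq_bigr => k _; rewrite derCM // !mxE.
Qed.

Lemma pderC_adj p q a (F : E -> 'M[C]_(p, q)) x :
  diffC_mx F x -> pderC a (fun y => adj (F y)) x = adj (pderC a F x).
Proof.
move=> dF; apply/matrixP => b c; rewrite !mxE.
by under eq_fun do rewrite !mxE; exact: derC_conj.
Qed.

Lemma near_pderC p q a (F G : E -> 'M[C]_(p, q)) x :
  (\near x, F x = G x) -> pderC a F x = pderC a G x.
Proof.
move=> FG; apply/matrixP => b c; rewrite !mxE; apply: near_derC.
by apply: filterS FG => y ->.
Qed.

End Matrices.

Section Smooth.
Variable U : set E.
Hypothesis oU : open U.

Lemma smoothC_diff f x : smoothC U f -> U x -> diffC f x.
Proof. by move=> [f1 f2] Ux; split; [have [+ _] := f1 1%N|have [+ _] := f2 1%N]; exact. Qed.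

Lemma smoothC_derC v f : smoothC U f -> smoothC U (derC v f).
Proof.
move=> [f1 f2]; split => k; [have [_ d] := f1 k.+1|have [_ d] := f2 k.+1]; exact: d.
Qed.

Lemma smoothC_derC_comm u v f x : smoothC U f -> U x ->
  derC v (derC u f) x = derC u (derC v f) x.
Proof.
move=> [f1 f2] Ux; rewrite /derC /=.
have sw (h : E -> R) : smooth U h -> 'D_v ('D_u h) x = 'D_u ('D_v h) x.
  move=> sh; have [d1 d2] := sh 2%N.
  have nU P : (forall y, U y -> P y) -> \forall y \near x, P y.
    by move=> UP; apply: filterS (open_nbhs_nbhs (conj oU Ux)) => y; exact: UP.
  apply: derive_comm.
  - exact: nU d1.
  - by have [d3 _] := d2 u; exact: nU d3.
  - by have [d3 _] := d2 v; exact: nU d3.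
  - by have [_ d3] := d2 u; exact: d3 v x Ux.
  - by have [_ d3] := d2 v; exact: d3 u x Ux.
exact: (f_equal2 (@Complex R) (sw _ f1) (sw _ f2)).
Qed.

Lemma holomorphicJ v f x : holomorphic U f -> U x ->
  derC (v *m cplxJ R n) f x = 'i * derC v f x.
Proof.
move=> [_ df] Ux; have := df x Ux v; rewrite /delbar => /eqP.
rewrite mulf_eq0 invr_eq0 pnatr_eq0 /= addr_eq0 => /eqP ->.
by rewrite mulrN mulrA; simpc.
Qed.

End Smooth.

End ComplexCalculus.

Section LinearCombinations.
Variables (R : realType) (n : nat).
Local Notation E := 'rV[R]_(n + n).
Local Notation C := R[i].
Local Notation e := (Defs.basis R).

Lemma diffC_mxZ p q (c : C) (F : E -> 'M[C]_(p, q)) x :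
  diffC_mx F x -> diffC_mx (fun y => c *: F y) x.
Proof.
move=> dF a b; under eq_fun do rewrite mxE.
by apply: diffCM (dF a b); exact: diffC_cst.
Qed.

Lemma pderCZ p q a (c : C) (F : E -> 'M[C]_(p, q)) x :
  diffC_mx F x -> pderC a (fun y => c *: F y) x = c *: pderC a F x.
Proof.
move=> dF; apply/matrixP => b d; rewrite !mxE; under eq_fun do rewrite mxE.
by rewrite derCM ?derC_cst ?mul0r ?add0r //; exact: diffC_cst.
Qed.

Lemma pderC_sum (I : finType) p q a (F : I -> E -> 'M[C]_(p, q)) x :
  (forall k, diffC_mx (F k) x) ->
  pderC a (fun y => \sum_k F k y) x = \sum_k pderC a (F k) x.
Proof.
move=> dF; apply/matrixP => b d; rewrite !mxE summxE; under eq_fun do rewrite summxE.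
by rewrite derC_sum => [|k]; [apply: eq_bigr => k _; rewrite mxE|exact: dF].
Qed.

(** The gradient enters through functions [M b] that agree with it near x, so that an expression in
    covariant derivatives can be differentiated in place of the raw partial derivatives. *)
Lemma hessian_local_max (f : E -> C) (M : 'I_(n + n) -> E -> C) x (w : E) :
  (\forall y \near x, diffC f y) ->
  (\forall y \near x, forall b, derC (e b) f y = M b y) ->
  (forall b, diffC (M b) x) ->
  (\forall y \near x, complex.Re (f y) <= complex.Re (f x)) ->
  complex.Re (\sum_a \sum_b (w 0 a * w 0 b)%:C * derC (e a) (M b) x) <= 0.
Proof.
move=> df fM dM fmax.
pose Mw y := \sum_b (w 0 b)%:C * M b y.
have dMw : diffC Mw x.
  by apply: diffC_sum => b; apply: diffCM (dM b); exact: diffC_cst.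
have Dw : \near x, complex.Re (Mw x) = 'D_w (fun y => complex.Re (f y)) x.
  apply: filterS2 df fM => y dfy fMy.
  rewrite -[RHS]/(complex.Re (derC w f y)) derC_basis //.
  by congr complex.Re; apply: eq_bigr => b _; rewrite fMy.
have -> : complex.Re (\sum_a \sum_b (w 0 a * w 0 b)%:C * derC (e a) (M b) x)
          = 'D_w ('D_w (fun y => complex.Re (f y))) x.
  rewrite -(near_eq_derive _ Dw) -[RHS]/(complex.Re (derC w Mw x)) derC_basis //.
  congr complex.Re; apply: eq_bigr => a _; rewrite derC_sum => [|b]; last first.
    by apply: diffCM (dM b); exact: diffC_cst.
  rewrite mulr_sumr; apply: eq_bigr => b _.
  rewrite (derCM _ (diffC_cst _ _) (dM b)) derC_cst mul0r add0r.
  by rewrite mulrA rmorphM.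
apply: derive2_local_max => //.
  by apply: filterS df => y [].
apply: near_eq_derivable Dw _; apply: diff_derivable.
by have [] := dMw.
Qed.

End LinearCombinations.

(** * The Hessian of the norm of a section *)

Section Adjoint.
Variable R : realType.
Local Notation C := R[i].
Implicit Types p q r : nat.

Lemma adjE p q (A : 'M[C]_(p, q)) i j : adj A i j = conjc (A j i).
Proof. by rewrite !mxE. Qed.

Lemma adjD p q (A B : 'M[C]_(p, q)) : adj (A + B) = adj A + adj B.
Proof. by rewrite /adj map_mxD linearD. Qed.

Lemma adjM p q r (A : 'M[C]_(p, q)) (B : 'M[C]_(q, r)) : adj (A *m B) = adj B *m adj A.
Proof. by rewrite /adj map_mxM trmx_mul. Qed.

Lemma adjK p q (A : 'M[C]_(p, q)) : adj (adj A) = A.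
Proof. by apply/matrixP => i j; rewrite !mxE conjcK. Qed.

Lemma adjZ_real p q (k : R) (A : 'M[C]_(p, q)) : adj (k%:C *: A) = k%:C *: adj A.
Proof. by apply/matrixP => i j; rewrite !mxE rmorphM /= oppr0. Qed.

Lemma adj_sum (I : finType) p q (F : I -> 'M[C]_(p, q)) :
  adj (\sum_i F i) = \sum_i adj (F i).
Proof.
apply/matrixP => i j; rewrite summxE !mxE summxE rmorph_sum.
by apply: eq_bigr => k _; rewrite !mxE.
Qed.

End Adjoint.

Section Bochner.
Variables (R : realType) (n r : nat).
Local Notation E := 'rV[R]_(n + n).
Local Notation C := R[i].
Local Notation e := (Defs.basis R).
Local Notation J := (cplxJ R n).
Variables (U : set E) (s : E -> 'rV[C]_r) (H : E -> 'M[C]_r) (A : 'I_(n + n) -> E -> 'M[C]_r).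
Hypothesis oU : open U.
Hypothesis s_hol : forall b, holomorphic U (fun y => s y 0 b).
Hypothesis H_smooth : smoothC_mx U H.
Hypothesis A_smooth : forall a, smoothC_mx U (A a).
Hypothesis A_type10 : forall y, U y -> forall a,
  \sum_b (J a b)%:C *: A b y = 'i *: A a y.
Hypothesis A_herm : forall y, U y -> forall a,
  pderC a H y = A a y *m H y + H y *m adj (A a y).

Definition covd a (u : E -> 'rV[C]_r) y := pderC a u y + u y *m A a y.

Let Ds b := covd b s.

Lemma near_U (P : E -> Prop) x : U x -> (forall y, U y -> P y) -> \forall y \near x, P y.
Proof. by move=> Ux UP; apply: filterS (open_nbhs_nbhs (conj oU Ux)) => y; exact: UP. Qed.

Lemma diff_s y : U y -> diffC_mx s y.
Proof. by move=> Uy i b; rewrite ord1; have [sm _] := s_hol b; exact: smoothC_diff sm Uy. Qed.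

Lemma diff_H y : U y -> diffC_mx H y.
Proof. by move=> Uy i j; exact: smoothC_diff (H_smooth i j) Uy. Qed.

Lemma diff_A a y : U y -> diffC_mx (A a) y.
Proof. by move=> Uy i j; exact: smoothC_diff (A_smooth a i j) Uy. Qed.

Lemma diff_ds b y : U y -> diffC_mx (pderC b s) y.
Proof.
move=> Uy i j; under eq_fun do rewrite mxE; rewrite ord1; have [sm _] := s_hol j.
exact: smoothC_diff (smoothC_derC _ sm) Uy.
Qed.

Lemma diff_cov b y : U y -> diffC_mx (Ds b) y.
Proof.
by move=> Uy; apply: diffC_mxD; [exact: diff_ds|apply: diffC_mxM; [exact: diff_s|exact: diff_A]].
Qed.

Lemma cov_herm a (u w : E -> 'rV[C]_r) y : U y -> diffC_mx u y -> diffC_mx w y ->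
  pderC a (fun z => u z *m H z *m adj (w z)) y
  = covd a u y *m H y *m adj (w y) + u y *m H y *m adj (covd a w y).
Proof.
move=> Uy du dw; have dH := diff_H Uy; have duH := diffC_mxM du dH.
rewrite (pderCM _ duH (diffC_adj dw)) (pderCM _ du dH) (A_herm Uy) (pderC_adj _ dw).
rewrite /covd adjD adjM !mulmxDl !mulmxDr !mulmxDl !mulmxA.
by rewrite -!addrA; congr (_ + (_ + _)); exact: addrC.
Qed.

(** The Cauchy-Riemann equations for [s] give this for the partial derivatives, and the type of the
    connection matrices gives it for the remaining term. *)
Lemma cov_type10 b y : U y -> \sum_c (J b c)%:C *: Ds c y = 'i *: Ds b y.
Proof.
move=> Uy; rewrite /Ds /covd.
under eq_bigr do rewrite scalerDr scalemxAr.
rewrite big_split -mulmx_sumr (A_type10 Uy) /= scalerDr scalemxAr; congr (_ + _).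
apply/rowP => k; rewrite summxE [RHS]mxE [pderC b s y 0 k]mxE.
rewrite -(holomorphicJ _ (s_hol k) Uy) derC_basis; last exact: diff_s Uy 0 k.
by apply: eq_bigr => c _; rewrite -rowE !mxE.
Qed.

Variable x : E.
Hypothesis Ux : U x.

(** Derivatives along coordinate fields, with no connection on the tangent bundle: these fields
    commute, so the commutator is exactly the curvature, and [J] is constant in the chart, so the
    type (1,0) in the second index survives. *)
Let DDs a b := covd a (Ds b) x.

Lemma cov2_type10 a b : \sum_c (J b c)%:C *: DDs a c = 'i *: DDs a b.
Proof.
rewrite /DDs /covd; under eq_bigr do rewrite scalerDr scalemxAl.
rewrite big_split -mulmx_suml (cov_type10 _ Ux) /=.
rewrite [RHS]scalerDr [X in _ = _ + X]scalemxAl.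
congr (_ + _).
rewrite -(pderCZ _ _ (diff_cov b Ux)).
under eq_bigr do rewrite -(pderCZ _ _ (diff_cov _ Ux)).
rewrite -pderC_sum => [|c]; last exact: diffC_mxZ (diff_cov c Ux).
(* The type condition holds on all of the open set [U], so it may be differentiated at x. *)
by apply: near_pderC; apply: near_U Ux _ => y Uy; rewrite cov_type10.
Qed.

Let K a b := pderC a (A b) x - pderC b (A a) x + A b x *m A a x - A a x *m A b x.

(** The partial second derivatives cancel by symmetry and the mixed first-order terms pair off.
    Connection matrices act on rows from the right, which fixes the order of the products in [K]. *)
Lemma cov2_comm a b : DDs a b - DDs b a = s x *m K a b.
Proof.
rewrite /K.
have E1 c d : DDs c d = pderC c (pderC d s) x + pderC c s x *m A d x
    + s x *m pderC c (A d) x + pderC d s x *m A c x + s x *m A d x *m A c x.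
  rewrite /DDs {1}/covd /Ds {2}/covd mulmxDl addrA; congr (_ + _ + _).
  rewrite (pderCD _ (diff_ds d Ux) (diffC_mxM (diff_s Ux) (diff_A d Ux))).
  by rewrite (pderCM _ (diff_s Ux) (diff_A d Ux)) addrA.
have E2 : pderC a (pderC b s) x = pderC b (pderC a s) x.
  apply/matrixP => i j; rewrite [LHS]mxE [RHS]mxE ord1.
  have E c : (fun y => pderC c s y 0 j) = derC (e c) (fun y => s y 0 j).
    by apply/funext => y; rewrite mxE.
  by rewrite !E; have [sm _] := s_hol j; exact: (smoothC_derC_comm oU _ _ sm Ux).
rewrite !E1 E2 !mulmxBr mulmxDr mulmxBr !mulmxA.
move: (pderC b (pderC a s) x) (pderC a s x *m _) (pderC b s x *m _) => p q t.
move: (s x *m pderC _ _ _) (s x *m pderC _ _ _) (s x *m _ *m _) (s x *m _ *m _) => *.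
by apply/matrixP => i j; rewrite !mxE; ring.
Qed.

Lemma hessian_herm a b :
  pderC a (fun z => Ds b z *m H z *m adj (s z) + s z *m H z *m adj (Ds b z)) x
  = DDs a b *m H x *m adj (s x) + Ds b x *m H x *m adj (Ds a x)
    + (Ds a x *m H x *m adj (Ds b x) + s x *m H x *m adj (DDs a b)).
Proof.
have dD c := diff_cov c Ux; have ds := diff_s Ux; have dH := diff_H Ux.
rewrite pderCD; last 2 first.
- by apply: diffC_mxM; [exact: diffC_mxM|exact: diffC_adj].
- by apply: diffC_mxM; [exact: diffC_mxM|exact: diffC_adj].
by rewrite !cov_herm.
Qed.

(* J-invariance of [Q] cancels the symmetric part of the second covariant
   derivatives of [s], so that only their commutator contributes. *)
Lemma bochner (Q : 'M[R]_(n + n)) :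
  Q^T = Q -> J *m Q = Q *m J -> (forall v : E, 0 <= (v *m Q *m v^T) 0 0) ->
  adj (H x) = H x -> (forall u : 'rV_r, 0 <= (u *m H x *m adj u) 0 0) ->
  (\forall y \near x, complex.Re ((s y *m H y *m adj (s y)) 0 0)
                   <= complex.Re ((s x *m H x *m adj (s x)) 0 0)) ->
  0 <= complex.Re ((s x *m ('i / 2 *: \sum_a \sum_b ((J *m Q) a b)%:C *: K a b)
                    *m H x *m adj (s x)) 0 0).
Proof.
move=> QT JQ Qpos HT Hpos smax.
(* The gradient of the squared norm, by compatibility of the connection with the Hermitian
   metric. *)
pose M b z := (Ds b z *m H z *m adj (s z) + s z *m H z *m adj (Ds b z)) 0 0.
pose T := \sum_a \sum_b (Q a b)%:C *: DDs a b.
have TE : T = - (s x *m ('i / 2 *: \sum_a \sum_b ((J *m Q) a b)%:C *: K a b)).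
  rewrite /T (sum_J_invariant (cplxJ_tr R n) QT JQ cov2_type10).
  rewrite scaleNr; congr (- _); rewrite -scalemxAr; congr (_ *: _).
  rewrite mulmx_sumr; apply: eq_bigr => a _; rewrite mulmx_sumr.
  by apply: eq_bigr => b _; rewrite cov2_comm scalemxAr.
have hess (w : E) :
    complex.Re (\sum_a \sum_b (w 0 a * w 0 b)%:C * derC (e a) (M b) x) <= 0.
  apply: (hessian_local_max (f := fun y => (s y *m H y *m adj (s y)) 0 0)) => //.
  - apply: near_U Ux _ => y Uy; have ds := diff_s Uy.
    exact: diffC_mxM (diffC_mxM ds (diff_H Uy)) (diffC_adj ds) 0 0.
  - apply: near_U Ux _ => y Uy b; have ds := diff_s Uy.
    by have /matrixP/(_ 0 0) := cov_herm b Uy ds ds; rewrite mxE.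
  - move=> b; have ds := diff_s Ux; have dD := diff_cov b Ux; have dH := diff_H Ux.
    apply: (@diffC_mxD _ _ _ _ (fun z => Ds b z *m H z *m adj (s z))
      (fun z => s z *m H z *m adj (Ds b z)) x _ _ 0 0).
      exact: diffC_mxM (diffC_mxM dD dH) (diffC_adj ds).
    exact: diffC_mxM (diffC_mxM ds dH) (diffC_adj dD).
(* The Hessian is nonpositive along each row of [V]; summing over the rows gives its contraction
   with [Q]. *)
have [V QV] := psd_factor QT Qpos.
have traced : complex.Re (\sum_a \sum_b (Q a b)%:C * derC (e a) (M b) x) <= 0.
  have -> : \sum_a \sum_b (Q a b)%:C * derC (e a) (M b) x
    = \sum_k \sum_a \sum_b (row k V 0 a * row k V 0 b)%:C * derC (e a) (M b) x.
    rewrite [RHS]exchange_big; apply: eq_bigr => a _ /=.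
    rewrite [RHS]exchange_big; apply: eq_bigr => b _ /=.
    rewrite QV mxE rmorph_sum mulr_suml; apply: eq_bigr => k _.
    by rewrite !mxE.
  by rewrite raddf_sum; apply: sumr_le0 => k _; exact: hess.
pose P := \sum_a \sum_b (Q a b)%:C * (Ds a x *m H x *m adj (Ds b x)) 0 0.
have P_ge0 : 0 <= P by exact: sum_psd_sesqui.
have PE : \sum_a \sum_b (Q a b)%:C * (Ds b x *m H x *m adj (Ds a x)) 0 0 = P.
  rewrite exchange_big; apply: eq_bigr => a _; apply: eq_bigr => b _ /=.
  by rewrite -{1}QT mxE.
pose t := (T *m H x *m adj (s x)) 0 0.
have E1 : \sum_a \sum_b (Q a b)%:C * derC (e a) (M b) x = t + P + (P + conjc t).
  have tE : \sum_a \sum_b (Q a b)%:C * (DDs a b *m H x *m adj (s x)) 0 0 = t.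
    rewrite /t !mulmx_suml summxE; apply: eq_bigr => a _.
    rewrite !mulmx_suml summxE; apply: eq_bigr => b _.
    move: (DDs a b) (H x) (adj (s x)) => D G z.
    by rewrite -!scalemxAl [RHS]mxE.
  (* Hermitian symmetry of [H x] makes the terms with two derivatives on the second factor conjugate
     to those on the first. *)
  have tE' : \sum_a \sum_b (Q a b)%:C * (s x *m H x *m adj (DDs a b)) 0 0 = conjc t.
    have -> : conjc t = (s x *m H x *m adj T) 0 0.
      have -> : s x *m H x *m adj T = adj (T *m H x *m adj (s x)).
        by rewrite !adjM adjK HT mulmxA.
      by rewrite adjE.
    rewrite /T adj_sum mulmx_sumr summxE; apply: eq_bigr => a _.
    rewrite adj_sum mulmx_sumr summxE; apply: eq_bigr => b _.
    move: (DDs a b) (s x *m H x) => D z.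
    by rewrite adjZ_real -scalemxAr [RHS]mxE.
  rewrite -{1}tE -{1}PE -tE' /P -!big_split /=; apply: eq_bigr => a _.
  rewrite -!big_split /=; apply: eq_bigr => b _; rewrite -!mulrDr; congr (_ * _).
  have addE (B1 B2 B3 B4 : 'M[C]_1) :
    B1 0 0 + B2 0 0 + (B3 0 0 + B4 0 0) = (B1 + B2 + (B3 + B4)) 0 0 by rewrite !mxE.
  by rewrite addE -hessian_herm [RHS]mxE.
move: traced; rewrite E1 !ReD.
have -> : complex.Re (conjc t) = complex.Re t by case: (t).
have : 0 <= complex.Re P by move: P_ge0; rewrite lecE => /andP[].
rewrite /t TE !mulNmx mxE.
have ReN (z : C) : complex.Re (- z) = - complex.Re z by case: z.
by rewrite ReN; lra.
Qed.

End Bochner.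

(** * Charts and trivializations *)

Section VaismanChart.
Variables (R : realType) (n : nat) (M : complexManifold R n).
Local Notation E := 'rV[R]_(n + n).
Local Notation C := R[i].
Local Notation J := (cplxJ R n).
Local Notation coord := Defs.coord.
Local Notation point := Defs.point.

(** Inside the open image of the chart, this set is the preimage of [W] under the continuous
    [point i]. *)
Lemma chart_image_open (i : chart_index M) (W : set M) : open W -> open (chart_image i W).
Proof.
move=> oW; rewrite openE => y [q [dq Wq] qy].
have iy : (coord i @` dom i) y by exists q.
have pyq : point i y = q by rewrite -qy coordK.
have n1 : nbhs y (coord i @` dom i) by apply: open_nbhs_nbhs; split=> //; exact: image_open.
have n2 : nbhs y (point i @^-1` W).
  by apply: (point_continuous iy); rewrite pyq; apply: open_nbhs_nbhs.
rewrite /interior; apply: filterS2 n1 n2 => z [q' dq' <-]; rewrite /preimage /= coordK // => Wq'.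
by exists q'.
Qed.

Lemma metric_unit (g : hermitianMetric M) i x : chart_image i setT x -> g i x \in unitmx.
Proof.
move=> Ux; rewrite -row_free_unit -kermx_eq0; apply/rowV0P => v /sub_kermxP vG.
apply/eqP/negPn/negP => v0; have := Defs.metric_pos g Ux v0.
by rewrite vG mul0mx mxE ltxx.
Qed.

(** From the definitions, [del v f x - delbar v f x] is [- 'i] times the derivative of [f] along
    [v *m J]. Dividing by ['i] leaves a real derivative with sign -1, whence the order of the two
    terms. *)
Lemma omega0_lee (theta : oneForm M) i x : chart_image i setT x ->
  let dth := \matrix_(a, b) pder a (theta i) x b 0 in
  omega0 theta i x = map_mx (fun t => t%:C) ((J *m dth)^T - J *m dth).
Proof.
move=> Ux dth.
have dT b : diffC (fun y => (theta i y b 0)%:C) x.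
  split; last exact: differentiable_cst.
  by have [+ _] := @form_smooth _ _ _ theta i b 0 1%N; exact.
have dJ a b : derC (Defs.basis R a *m J) (fun y => (theta i y b 0)%:C) x
              = ((J *m dth) a b)%:C.
  rewrite (derC_basis _ (dT b)) mxE rmorph_sum; apply: eq_bigr => c _.
  by rewrite -rowE [row a J 0 c]mxE rmorphM !mxE /derC derive_cst.
apply/matrixP => a b; rewrite /omega0 /dc1 /del1 /delbar1 /del /delbar.
have mE (P Q : 'M[C]_(n + n)) (c : C) : (c *: (P - Q)) a b = c * (P a b - Q a b).
  by rewrite !mxE.
rewrite mE ![(\matrix_(_, _) _) a b]mxE !dJ.
have -> : map_mx (fun t => t%:C) ((J *m dth)^T - J *m dth) a b
          = ((J *m dth) b a)%:C - ((J *m dth) a b)%:C :> C.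
  by rewrite [LHS]mxE [((J *m dth)^T - _) a b]mxE [(J *m dth)^T a b]mxE
    [(- (J *m dth)) a b]mxE rmorphB.
move: (derC _ _ _) (derC _ _ _) ((J *m dth) a b)%:C ((J *m dth) b a)%:C => p q u v.
by field; exact: neq0Ci.
Qed.

(** By [dc_lee], [omega0] is [J *m Q] with both indices lowered, where [Q] is the transversal
    cometric, so pairing with it is contraction with [J *m Q]. *)
Lemma Lambda0_cometric (g : hermitianMetric M) (theta : oneForm M) i x eta :
  is_Vaisman g theta -> chart_image i setT x ->
  Lambda0 g theta i x eta
  = 2^-1 * \sum_a \sum_b ((J *m transversal_cometric (g i x) (theta i x) J) a b)%:C * eta a b.
Proof.
move=> [[_ [W [Wtf Wg WJ]]] [L [[Ltf Lg] Lth]] th1] Ux.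
have GT := Defs.metric_sym g Ux; have Gu := metric_unit g Ux.
rewrite /Lambda0 (omega0_lee _ Ux).
rewrite (@dc_lee _ _ _ _ GT Gu (th1 i x Ux) J (cplxJ_tr R n) (cplxJ_sqr R n)
  (Defs.metric_hermitian g Ux) (fun a => pder a (g i) x) (W i x) (L i x)).
- exact: form2_dot_contract.
- exact: Wtf.
- exact: Ltf.
- exact: Wg.
- exact: Lg.
- exact: WJ.
- move=> a b; have /eqP := Lth i x Ux a; rewrite subr_eq0 => /eqP E.
  by rewrite -E mxE.
Qed.

End VaismanChart.

(** * Local frames and the norm of a section *)

Section LocalTrivialization.
Variables (R : realType) (n r : nat) (M : complexManifold R n).
Variables (B : holomorphicBundle M r) (h : hermitianStructure B).
Local Notation E := 'rV[R]_(n + n).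
Local Notation C := R[i].
Local Notation coord := Defs.coord.
Local Notation point := Defs.point.

Lemma herm0l p (w : B p) : h p 0 w = 0.
Proof.
have := herm_linear h 1 0 0 w; rewrite scale1r addr0 mul1r => /eqP.
by rewrite -subr_eq0 opprD addrA subrr sub0r oppr_eq0 => /eqP.
Qed.

Lemma herm_suml (I : Type) (l : seq I) p (c : I -> C) (u : I -> B p) w :
  h p (\sum_(i <- l) c i *: u i) w = \sum_(i <- l) c i * h p (u i) w.
Proof.
elim: l => [|i l IH]; first by rewrite !big_nil herm0l.
by rewrite !big_cons herm_linear IH.
Qed.

Lemma herm_sumr (I : Type) (l : seq I) p (c : I -> C) (u : B p) (w : I -> B p) :
  h p u (\sum_(i <- l) c i *: w i) = \sum_(i <- l) conjc (c i) * h p u (w i).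
Proof.
rewrite herm_sym herm_suml rmorph_sum; apply: eq_bigr => i _.
by rewrite rmorphM /= -herm_sym.
Qed.

Lemma frame_expand k p (u : B p) : tdom k p ->
  u = \sum_a triv k p u 0 a *: frame k p (delta_mx 0 a).
Proof.
move=> kp; rewrite -[LHS](trivK kp); apply: (can_inj (trivK kp)).
rewrite frameK // linear_sum {1}[triv k p u]row_sum_delta.
by apply: eq_bigr => a _; rewrite linearZ frameK.
Qed.

Lemma herm_gram k i p (u w : B p) : tdom k p -> dom i p ->
  h p u w = (triv k p u *m gram h k i (coord i p) *m adj (triv k p w)) 0 0.
Proof.
move=> kp ip; rewrite {1}(frame_expand u kp) {1}(frame_expand w kp) herm_suml.
rewrite /gram coordK // -mulmxA mxE; apply: eq_bigr => a _; congr (_ * _).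
rewrite herm_sumr mxE; apply: eq_bigr => b _.
by rewrite [in RHS]mxE adjE mulrC.
Qed.

Lemma gram_adj k i y : adj (gram h k i y) = gram h k i y.
Proof. by apply/matrixP => a b; rewrite adjE !mxE -herm_sym. Qed.

Lemma gram_smooth k i : smoothC_mx (chart_image i (tdom k)) (gram h k i).
Proof.
move=> a b; have := @herm_smooth _ _ _ _ _ h k a b i.
by congr (smoothC _ _); apply/funext => y; rewrite mxE.
Qed.

Lemma gram_psd k i p (u : 'rV_r) : tdom k p -> dom i p ->
  0 <= (u *m gram h k i (coord i p) *m adj u) 0 0.
Proof.
move=> kp ip; rewrite -(frameK kp u) -herm_gram //.
have [->|u0] := eqVneq (frame k p u : B p) 0; first by rewrite herm0l.
exact/ltW/herm_pos.
Qed.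

Variable s : forall p : M, B p.
Definition local_section k i y := triv k (point i y) (s (point i y)).

Lemma sec_gram k i p : tdom k p -> dom i p ->
  (local_section k i (coord i p) *m gram h k i (coord i p)
   *m adj (local_section k i (coord i p))) 0 0
  = h p (s p) (s p).
Proof. by move=> kp ip; rewrite (herm_gram _ _ kp ip) /local_section coordK. Qed.

Hypothesis s_hol : holomorphic_section s.

(** The fibers carry no topology, so continuity is read off from the smoothness of the Gram matrix
    and of the components of [s] in one chart and one frame around each point. *)
Lemma continuous_norm : continuous (fun p : M => complex.Re (h p (s p) (s p))).
Proof.
move=> p; have [i ip] := dom_cover p; have [k kp] := tdom_cover B p.
pose U := chart_image i (tdom (h := B) k).
have oU : open U by apply: chart_image_open; exact: tdom_open.
have Ux : U (coord i p) by exists p.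
pose N y := complex.Re ((local_section k i y *m gram h k i y *m adj (local_section k i y)) 0 0).
have cN : {for coord i p, continuous N}.
  apply: differentiable_continuous.
  have ds := diff_s (s := local_section k i) (fun b => s_hol k b i) Ux.
  have dH := diff_H (@gram_smooth k i) Ux.
  by have [] := diffC_mxM (diffC_mxM ds dH) (diffC_adj ds) 0 0.
have cNp : {for p, continuous (N \o coord i)}.
  apply: continuous_comp; [exact: Defs.coord_continuous|exact: cN].
have E : \forall q \near p, (N \o coord i) q = complex.Re (h q (s q) (s q)).
  have n1 : nbhs p (dom i) by apply: open_nbhs_nbhs; split => //; exact: dom_open.
  have n2 : nbhs p (tdom (h := B) k).
    by apply: open_nbhs_nbhs; split => //; exact: tdom_open.
  by apply: filterS2 n1 n2 => q iq kq; rewrite /N /= sec_gram.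
rewrite /continuous_at -(nbhs_singleton E).
apply: cvg_trans cNp; exact: near_eq_cvg.
Qed.

End LocalTrivialization.

(** * The maximum principle on the compact manifold *)

Theorem theorem9p5 (R : realType) (n r : nat) (M : complexManifold R n)
    (g : hermitianMetric M) (theta : oneForm M)
    (B : holomorphicBundle M r) (h : hermitianStructure B)
    (D : bundleConnection B)
    (M_compact : compact [set: M])
    (M_Vaisman : is_Vaisman g theta)
    (D_chern : chern_connection h D)
    (D_negative : strictly_negative_curvature g theta h D)
    (s : forall p : M, B p) (s_holomorphic : holomorphic_section s) :
  forall p : M, s p = 0.
Proof.
move=> p; apply/eqP/negPn/negP => sp.
pose f q := complex.Re (h q (s q) (s q)).
have f_pos q : s q != 0 -> 0 < f q.
  by move=> /(herm_pos h); rewrite ltcE => /andP[].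
have [p0 _ p0_max] : exists2 c, c \in [set: M] & forall t, t \in [set: M] -> f t <= f c.
  apply: compact_EVT_max => //; first by exists p.
  exact/continuous_subspaceT/continuous_norm.
have {sp} sp0 : s p0 != 0.
  apply/eqP => s0; have := lt_le_trans (f_pos p sp) (p0_max p (in_setT _)).
  by rewrite /f s0 herm0l ltxx.
have [i ip] := dom_cover p0; have [k kp] := tdom_cover B p0.
pose U := chart_image i (tdom (h := B) k); pose x := Defs.coord i p0.
have oU : open U by apply: chart_image_open; exact: tdom_open.
have Ux : U x by exists p0.
have Ix : chart_image i [set: M] x by exists p0.
have [_ _ th1] := M_Vaisman.
have GT := Defs.metric_sym g Ix; have Gu := metric_unit g Ix.
have JG := Defs.metric_hermitian g Ix; have JT := cplxJ_tr R n; have J2 := cplxJ_sqr R n.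
(* [Q] is a constant matrix, taken at the maximum point only. *)
set Q := transversal_cometric (g i x) (theta i x) (cplxJ R n).
have QT : Q^T = Q := transversal_tr _ GT _.
have JQ : cplxJ R n *m Q = Q *m cplxJ R n := transversal_commute _ Gu JT J2 JG.
have Qpos (v : 'rV[R]_(n + n)) : 0 <= (v *m Q *m v^T) 0 0.
  exact: (transversal_psd GT Gu (th1 i x Ix) JT J2 JG _ (Defs.metric_pos g Ix)).
have [D10 Dh] := D_chern.
have := bochner (s := local_section s k i) (A := fun a y => D k i y a) oU
  (fun b => s_holomorphic k b i) (@gram_smooth _ _ _ _ _ h k i)
  (@bconn_smooth _ _ _ _ _ D k i) (D10 k i) (Dh k i) Ux QT JQ Qpos
  (gram_adj h k i x) (fun u => gram_psd h u kp ip).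
have K_neg := D_negative k i p0 kp ip (s p0) sp0.
(* The factor 1/2 of [Lambda0_cometric] is the one in the ['i / 2] of [bochner]. *)
have Lam : 'i *: Lambda0_end g theta i x (curvature D k i x)
  = ('i / 2) *: \sum_a \sum_b ((cplxJ R n *m Q) a b)%:C *: curvature D k i x a b.
  rewrite -scalerA; congr (_ *: _); apply/matrixP => l m.
  rewrite [LHS]mxE (Lambda0_cometric _ M_Vaisman Ix) [RHS]mxE summxE.
  congr (_ * _); apply: eq_bigr => a _; rewrite summxE; apply: eq_bigr => b _.
  by rewrite mxE [RHS]mxE.
rewrite (herm_gram _ _ _ kp ip) frameK // -/x Lam in K_neg.
have secE : local_section s k i x = triv k p0 (s p0) by rewrite /local_section coordK.
rewrite secE => bochner_x.
(* Negativity in [R[i]] contains strict negativity of the real part, which [bochner] contradicts at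
   the maximum. *)
move: K_neg; rewrite ltcE => /andP[_]; apply/negP; rewrite -leNgt; apply: bochner_x.
apply: (near_U oU Ux) => y [q [iq kq] <-].
by rewrite -secE !sec_gram //; exact: p0_max (in_setT _).
Qed.
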